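(* Let $(A^{o},b^{o})$ be an explicit (outer, slow) Runge-Kutta method with $s^{o}$ stages, coefficients $a^o_{i,j}$, and abscissae $c^o=A^o\mathbf 1$ satisfying $c^o_1=0$, $c^o_i<c^o_j$ for $i<j$, $c^o_{s^o}<1$, and let $(A^{i},b^{i})$ be an (inner, fast) Runge-Kutta method with $s^{i}$ stages and $c^i=A^i\mathbf 1$; assume $(b^o)^T\mathbf 1=1$ and $(b^i)^T\mathbf 1=1$. Consider the multirate infinitesimal step (MIS) scheme built from these two methods, as defined in the context, with one step of the inner method used for each internal ODE. (i) The MIS scheme can be written as a GARK method whose Butcher tableau is given by $\mathbf A^{\{\mathfrak s,\mathfrak s\}}=A^o$, $\mathbf b^{\{\mathfrak s\}}=b^o$, $$\mathbf A^{\{\mathfrak f,\mathfrak f\}}=\begin{bmatrix} c_2^o A^i & 0 & \cdots & 0\\ c_2^o\,\mathbf 1 (b^i)^T & (c_3^o-c_2^o)A^i & \cdots & 0\\ \vdots & & \ddots & \\ c_2^o\,\mathbf 1(b^i)^T & (c_3^o-c_2^o)\mathbf 1(b^i)^T & \cdots & (1-c^o_{s^o})A^i\end{bmatrix}\in\mathbb R^{s^os^i\times s^os^i},$$ $$(\mathbf b^{\{\mathfrak f\}})^T=\begin{bmatrix} c_2^o (b^i)^T & (c_3^o-c_2^o)(b^i)^T & \cdots & (1-c^o_{s^o})(b^i)^T\end{bmatrix},$$ $$\mathbf A^{\{\mathfrak f,\mathfrak s\}}=\begin{bmatrix} c^i\,\mathbf e_2^TA^o\\ \vdots\\ \mathbf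 1\,\mathbf e_{k-1}^TA^o + c^i(\mathbf e_k^T-\mathbf e_{k-1}^T)A^o\\ \vdots\\ \mathbf 1\,\mathbf e_{s^o}^TA^o + c^i\left((b^o)^T-\mathbf e_{s^o}^TA^o\right)\end{bmatrix}\in\mathbb R^{s^os^i\times s^o},$$ $$\mathbf A^{\{\mathfrak s,\mathfrak f\}}=\begin{bmatrix} c_2^o\,\mathbf g_2(b^i)^T & \cdots & (c^o_{s^o}-c^o_{s^o-1})\,\mathbf g_{s^o}(b^i)^T & \mathbf 0\end{bmatrix}\in\mathbb R^{s^o\times s^os^i},$$ where the blocks are indexed by $k=2,\dots,s^o+1$ (the generic block row of $\mathbf A^{\{\mathfrak f,\mathfrak s\}}$ shown being for $2\le k\le s^o$), $\mathbf e_k\in\mathbb R^{s^o}$ is the $k$-th unit vector, and $\mathbf g_k\in\mathbb R^{s^o}$ has entries $0$ in positions $1,\dots,k-1$ and $1$ in positions $k,\dots,s^o$. (ii) The coefficients fulfill the internal consistency conditions $$\mathbf A^{\{\mathfrak s,\mathfrak s\}}\mathbf 1=\mathbf A^{\{\mathfrak s,\mathfrak f\}}\mathbf 1=\mathbf c^{\{\mathfrak s\}}=c^o,\qquad \mathbf A^{\{\mathfrak f,\mathfrak s\}}\mathbf 1=\mathbf A^{\{\mathfrak f,\mathfrak f\}}\mathbf 1=\mathbf c^{\{\mathfrak f\}}=\begin{bmatrix} c_2^o\,c^i\\ \vdots\\ c^o_{k-1}\mathbf 1+(c^o_k-c^o_{k-1})c^i\\ \vdots\\ c^o_{s^o}\mathbf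 1+(1-c^o_{s^o})c^i\end{bmatrix}\in\mathbb R^{s^os^i}.$$ (iii) If both the fast method $(A^i,b^i)$ and the slow method $(A^o,b^o)$ have order at least two, then the overall scheme is second order. (iv) If both the fast method $(A^i,b^i)$ and the slow method $(A^o,b^o)$ have order at least three, then the third order coupling conditions $$(\mathbf b^{\{\mathfrak s\}})^T\mathbf A^{\{\mathfrak s,\mathfrak f\}}\mathbf c^{\{\mathfrak f\}}=\tfrac16,\qquad (\mathbf b^{\{\mathfrak f\}})^T\mathbf A^{\{\mathfrak f,\mathfrak s\}}\mathbf c^{\{\mathfrak s\}}=\tfrac16$$ reduce to (i.e. hold if and only if) the single condition $$\frac13=\sum_{k=2}^{s^o}(c^o_k-c^o_{k-1})(\mathbf e_k+\mathbf e_{k-1})^TA^oc^o+(1-c^o_{s^o})\left(\frac12+\mathbf e_{s^o}^TA^oc^o\right).$$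
   Context: Superscripts $o$ and $i$ stand for ''outer'' and ''inner'' (they are not exponents or indices). $\mathbf 1$ is the vector of ones. ''Explicit'' means $A^o$ is strictly lower triangular. MIS scheme. For $y'=f^{\{\mathfrak s\}}(y)+f^{\{\mathfrak f\}}(y)$ and step size $H$, the MIS method sets $Y_1^{\{\mathfrak s\}}=y_n$, and for $k=2,\dots,s^o$ defines $Y_k^{\{\mathfrak s\}}=v_k(H)$, where $v_k'=\sum_{j=1}^{k-1}(a^o_{k,j}-a^o_{k-1,j})f^{\{\mathfrak s\}}(Y_j^{\{\mathfrak s\}})+(c^o_k-c^o_{k-1})f^{\{\mathfrak f\}}(v_k)$ on $[0,H]$, $v_k(0)=Y^{\{\mathfrak s\}}_{k-1}$. Finally $y_{n+1}=v(H)$, where $v'=\sum_{j=1}^{s^o}(b^o_j-a^o_{s^o,j})f^{\{\mathfrak s\}}(Y_j^{\{\mathfrak s\}})+(1-c^o_{s^o})f^{\{\mathfrak f\}}(v)$, $v(0)=Y^{\{\mathfrak s\}}_{s^o}$. Each internal ODE is solved by one step of size $H$ of the inner method $(A^i,b^i)$. Explicitly, for $k=2,\dots,s^o$ and $q=1,\dots,s^i$, $$Y_{k,q}^{\{\mathfrak f\}}=Y_{k-1}^{\{\mathfrak s\}}+H c^i_q\sum_{j=1}^{k-1}(a^o_{k,j}-a^o_{k-1,j})f^{\{\mathfrak s\}}(Y_j^{\{\mathfrak s\}})+H(c^o_k-c^o_{k-1})\sum_{j=1}^{s^i}a^i_{q,j}f^{\{\mathfrak f\}}(Y_{k,j}^{\{\mathfrak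 f\}}),$$ $$Y_k^{\{\mathfrak s\}}=Y_{k-1}^{\{\mathfrak s\}}+H\sum_{j=1}^{k-1}(a^o_{k,j}-a^o_{k-1,j})f^{\{\mathfrak s\}}(Y_j^{\{\mathfrak s\}})+H(c^o_k-c^o_{k-1})\sum_{j=1}^{s^i}b^i_jf^{\{\mathfrak f\}}(Y_{k,j}^{\{\mathfrak f\}}),$$ and the last internal ODE gives, for $q=1,\dots,s^i$, $$Y_{s^o+1,q}^{\{\mathfrak f\}}=Y_{s^o}^{\{\mathfrak s\}}+Hc^i_q\sum_{j=1}^{s^o}(b^o_j-a^o_{s^o,j})f^{\{\mathfrak s\}}(Y_j^{\{\mathfrak s\}})+H(1-c^o_{s^o})\sum_{j=1}^{s^i}a^i_{q,j}f^{\{\mathfrak f\}}(Y_{s^o+1,j}^{\{\mathfrak f\}}),$$ $$y_{n+1}=Y_{s^o}^{\{\mathfrak s\}}+H\sum_{j=1}^{s^o}(b^o_j-a^o_{s^o,j})f^{\{\mathfrak s\}}(Y_j^{\{\mathfrak s\}})+H(1-c^o_{s^o})\sum_{j=1}^{s^i}b^i_jf^{\{\mathfrak f\}}(Y_{s^o+1,j}^{\{\mathfrak f\}}).$$ GARK method (two partitions). Given matrices $\mathbf A^{\{q,m\}}$ and vectors $\mathbf b^{\{q\}}$, $q,m\in\{\mathfrak f,\mathfrak s\}$, the generalized additive Runge-Kutta (GARK) method with step $H$ is $$Y_i^{\{q\}}=y_n+H\sum_{m\in\{\mathfrak f,\mathfrak s\}}\sum_j a_{i,j}^{\{q,m\}}f^{\{m\}}(Y_j^{\{m\}}),\qquad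 y_{n+1}=y_n+H\sum_{q\in\{\mathfrak f,\mathfrak s\}}\sum_i b_i^{\{q\}}f^{\{q\}}(Y_i^{\{q\}}),$$ where $a_{i,j}^{\{q,m\}}$, $b_i^{\{q\}}$ are the entries of $\mathbf A^{\{q,m\}}$, $\mathbf b^{\{q\}}$. For the MIS scheme the slow stages are $Y_k^{\{\mathfrak s\}}$, $k=1,\dots,s^o$, and the fast stages are $Y_{k,q}^{\{\mathfrak f\}}$, $k=2,\dots,s^o+1$, $q=1,\dots,s^i$, ordered by $k$ first, then $q$. Order $p$ of a method means that the local error after one step is $O(H^{p+1})$ for all sufficiently smooth right-hand sides. The two third order coupling conditions displayed in (iv) are the order-three conditions that remain for an internally consistent GARK method beyond the conditions on the individual methods $(\mathbf A^{\{\mathfrak f,\mathfrak f\}},\mathbf b^{\{\mathfrak f\}})$ and $(\mathbf A^{\{\mathfrak s,\mathfrak s\}},\mathbf b^{\{\mathfrak s\}})$. *)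

(* Defs.v *)
From HB Require Import structures.
From mathcomp Require Import all_boot all_order all_algebra.
From mathcomp Require Import all_classical all_reals all_analysis.

Set Implicit Arguments.
Unset Strict Implicit.
Unset Printing Implicit Defensive.

Import Order.TTheory GRing.Theory Num.Theory.
Import numFieldNormedType.Exports.

Local Open Scope classical_set_scope.
Local Open Scope ring_scope.

(* Right-hand sides and exact solutions *)

(* In finite dimension this is the usual class C^N: the directional
   derivatives of f are linear combinations of its partial derivatives. *)
Fixpoint Ck (R : realType) (d e : nat) (N : nat) (f : 'rV[R]_d -> 'rV[R]_e)
    : Prop :=
  match N with
  | 0%N => continuous f
  | N'.+1 => (forall x, differentiable f x) /\
             (forall v, Ck N' (fun x => 'D_v f x))
  end.

Definition ode_solution (R : realType) (d : nat) (F : 'rV[R]_d -> 'rV[R]_d)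
    (y0 : 'rV[R]_d) (T : R) (y : R -> 'rV[R]_d) : Prop :=
  y 0 = y0 /\ (forall t : R, `|t| < T -> is_derive t (1 : R) y (F (y t))).

(* [step H y0 Y y1] means that Y solves the stage equations of the method for
   step size H started at y0, and that y1 is the resulting new value.
   The stage equations may be implicit, hence may have spurious solutions that
   leave every bounded set as H tends to 0; the numerical solution is the one
   whose stages stay within a fixed distance r of y0.  It is required to exist
   for all small H > 0, so the error bound is never vacuous. *)
Definition local_error_order (R : realType) (d : nat) (I : Type) (p : nat)
    (F : 'rV[R]_d -> 'rV[R]_d)
    (step : R -> 'rV[R]_d -> (I -> 'rV[R]_d) -> 'rV[R]_d -> Prop) : Prop :=
  forall (y0 : 'rV[R]_d) (T : R) (y : R -> 'rV[R]_d),
    0 < T -> ode_solution F y0 T y ->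
    exists r C : R, 0 < r /\
      \forall H \near 0^'+,
        (exists (Y : I -> 'rV[R]_d) (y1 : 'rV[R]_d),
            step H y0 Y y1 /\ (forall i, `|Y i - y0| < r)) /\
        (forall (Y : I -> 'rV[R]_d) (y1 : 'rV[R]_d),
            step H y0 Y y1 -> (forall i, `|Y i - y0| < r) ->
            `|y1 - y H| <= C * H ^+ p.+1).

(* Runge-Kutta methods *)

Definition abscissae (R : realType) (s : nat) (A : 'M[R]_s) : 'cV[R]_s :=
  A *m const_mx 1.

Definition explicit_rk (R : realType) (s : nat) (A : 'M[R]_s) : Prop :=
  forall i j : 'I_s, (i <= j)%N -> A i j = 0.

Definition rk_step (R : realType) (s d : nat) (A : 'M[R]_s) (b : 'cV[R]_s)
    (f : 'rV[R]_d -> 'rV[R]_d)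
    (H : R) (y0 : 'rV[R]_d) (Y : 'I_s -> 'rV[R]_d) (y1 : 'rV[R]_d) : Prop :=
  (forall i, Y i = y0 + H *: \sum_(j < s) A i j *: f (Y j)) /\
  y1 = y0 + H *: \sum_(i < s) b i 0 *: f (Y i).

(* "Sufficiently smooth" means of class C^N for some N depending only on the
   method. *)
Definition rk_order (R : realType) (s : nat) (p : nat)
    (A : 'M[R]_s) (b : 'cV[R]_s) : Prop :=
  exists N : nat, forall (d : nat) (f : 'rV[R]_d.+1 -> 'rV[R]_d.+1),
    Ck N f -> local_error_order p f (rk_step A b f).

(* GARK methods with a fast and a slow partition *)

Definition gark_step (R : realType) (mf ms d : nat)
    (Aff : 'M[R]_mf) (Afs : 'M[R]_(mf, ms))
    (Asf : 'M[R]_(ms, mf)) (Ass : 'M[R]_ms)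
    (bf : 'cV[R]_mf) (bs : 'cV[R]_ms)
    (ff fs : 'rV[R]_d -> 'rV[R]_d) (H : R) (y0 : 'rV[R]_d)
    (Yf : 'I_mf -> 'rV[R]_d) (Ys : 'I_ms -> 'rV[R]_d) (y1 : 'rV[R]_d) : Prop :=
  [/\ forall i, Yf i = y0 + H *: (\sum_(j < mf) Aff i j *: ff (Yf j)
                                  + \sum_(j < ms) Afs i j *: fs (Ys j)),
      forall i, Ys i = y0 + H *: (\sum_(j < mf) Asf i j *: ff (Yf j)
                                  + \sum_(j < ms) Ass i j *: fs (Ys j))
    & y1 = y0 + H *: (\sum_(i < mf) bf i 0 *: ff (Yf i)
                      + \sum_(i < ms) bs i 0 *: fs (Ys i))].

(* MIS schemes.

   The outer method has n.+1 stages, numbered from 0.  There are n.+1 internal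
   ODEs: the one numbered [prv k], for k : 'I_n, leads from slow stage [prv k]
   (value k) to slow stage [nxt k] (value k + 1); the one numbered [ord_max]
   leads from the last slow stage to the new value.  With slow stages numbered
   1, ..., s = n.+1 and internal ODEs (and blocks) numbered 2, ..., s + 1 by
   the index of their end point, number l : 'I_n.+1 here is number l + 2. *)

Definition prv (n : nat) (k : 'I_n) : 'I_n.+1 := lift ord_max k.
Definition nxt (n : nat) (k : 'I_n) : 'I_n.+1 := lift ord0 k.

Definition mis_step (R : realType) (n si d : nat)
    (Ao : 'M[R]_n.+1) (bo : 'cV[R]_n.+1) (Ai : 'M[R]_si) (bi : 'cV[R]_si)
    (fs ff : 'rV[R]_d -> 'rV[R]_d) (H : R) (y0 : 'rV[R]_d)
    (Ys : 'I_n.+1 -> 'rV[R]_d) (Yf : 'I_n.+1 -> 'I_si -> 'rV[R]_d)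
    (y1 : 'rV[R]_d) : Prop :=
  let co := abscissae Ao in
  let ci := abscissae Ai in
  let slow (k : 'I_n) : 'rV[R]_d :=
    \sum_(j < n.+1 | (j < nxt k)%N)
       (Ao (nxt k) j - Ao (prv k) j) *: fs (Ys j) in
  let slow_last : 'rV[R]_d :=
    \sum_(j < n.+1) (bo j 0 - Ao ord_max j) *: fs (Ys j) in
  [/\ Ys ord0 = y0,
      forall (k : 'I_n) (q : 'I_si),
        Yf (prv k) q = Ys (prv k) + (H * ci q 0) *: slow k
          + (H * (co (nxt k) 0 - co (prv k) 0)) *:
              \sum_(j < si) Ai q j *: ff (Yf (prv k) j),
      forall k : 'I_n,
        Ys (nxt k) = Ys (prv k) + H *: slow k
          + (H * (co (nxt k) 0 - co (prv k) 0)) *: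
              \sum_(j < si) bi j 0 *: ff (Yf (prv k) j),
      forall q : 'I_si,
        Yf ord_max q = Ys ord_max + (H * ci q 0) *: slow_last
          + (H * (1 - co ord_max 0)) *:
              \sum_(j < si) Ai q j *: ff (Yf ord_max j)
    & y1 = Ys ord_max + H *: slow_last
          + (H * (1 - co ord_max 0)) *:
              \sum_(j < si) bi j 0 *: ff (Yf ord_max j)].

Definition mis_order (R : realType) (n si : nat) (p : nat)
    (Ao : 'M[R]_n.+1) (bo : 'cV[R]_n.+1) (Ai : 'M[R]_si) (bi : 'cV[R]_si)
    : Prop :=
  exists N : nat, forall (d : nat) (fs ff : 'rV[R]_d.+1 -> 'rV[R]_d.+1),
    Ck N fs -> Ck N ff ->
    local_error_order p (fun y => fs y + ff y)
      (fun H y0 (Y : 'I_n.+1 + 'I_n.+1 * 'I_si -> 'rV[R]_d.+1) y1 =>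
         mis_step Ao bo Ai bi fs ff H y0
           (fun k => Y (inl k)) (fun l q => Y (inr (l, q))) y1).

(* GARK tableau of an MIS scheme.

   [unlift ord_max l] is [Some k] when l = prv k, and [None] when l = ord_max.
   The fast coefficients are block matrices with n.+1 block rows or columns of
   size si; their index type 'I_(fast_dim n si) enumerates the pairs
   (block, position in the block) lexicographically, with projections
   [tagnat.sig1] and [tagnat.sig2]. *)

Definition fast_dim (n si : nat) : nat := (\sum_(l < n.+1) si)%N.

Definition unitv (R : realType) (s : nat) (k : 'I_s) : 'cV[R]_s :=
  delta_mx k 0.

Definition gvec (R : realType) (s : nat) (k : 'I_s) : 'cV[R]_s :=
  \col_(i < s) (if (k <= i)%N then 1 else 0).

(* The first increment is co 1 - co 0, i.e. co 1 when co 0 = 0. *)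
Definition increment (R : realType) (n : nat) (Ao : 'M[R]_n.+1)
    (l : 'I_n.+1) : R :=
  let co := abscissae Ao in
  if unlift ord_max l is Some k then co (nxt k) 0 - co (prv k) 0
  else 1 - co ord_max 0.

Definition mis_Aff (R : realType) (n si : nat) (Ao : 'M[R]_n.+1)
    (Ai : 'M[R]_si) (bi : 'cV[R]_si) : 'M[R]_(fast_dim n si) :=
  \mxblock_(k < n.+1, l < n.+1)
    (if (l < k)%N then increment Ao l *: (const_mx 1 *m bi^T)
     else if l == k then increment Ao l *: Ai
     else 0 : 'M[R]_(si, si)).

Definition mis_bf (R : realType) (n si : nat) (Ao : 'M[R]_n.+1)
    (bi : 'cV[R]_si) : 'cV[R]_(fast_dim n si) :=
  \mxcol_(l < n.+1) (increment Ao l *: bi).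

(* In the first block the terms in row 0 of Ao vanish for explicit methods. *)
Definition mis_Afs (R : realType) (n si : nat)
    (Ao : 'M[R]_n.+1) (bo : 'cV[R]_n.+1) (Ai : 'M[R]_si)
    : 'M[R]_(fast_dim n si, n.+1) :=
  let ci := abscissae Ai in
  \mxcol_(l < n.+1)
    (if unlift ord_max l is Some k then
       const_mx 1 *m ((unitv R (prv k))^T *m Ao)
       + ci *m ((unitv R (nxt k) - unitv R (prv k))^T *m Ao)
     else
       const_mx 1 *m ((unitv R ord_max)^T *m Ao)
       + ci *m (bo^T - (unitv R ord_max)^T *m Ao) : 'M[R]_(si, n.+1)).

Definition mis_Asf (R : realType) (n si : nat)
    (Ao : 'M[R]_n.+1) (bi : 'cV[R]_si) : 'M[R]_(n.+1, fast_dim n si) :=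
  \mxrow_(l < n.+1)
    (if unlift ord_max l is Some k then
       increment Ao l *: (gvec R (nxt k) *m bi^T)
     else 0 : 'M[R]_(n.+1, si)).

Definition mis_cf (R : realType) (n si : nat) (Ao : 'M[R]_n.+1)
    (Ai : 'M[R]_si) : 'cV[R]_(fast_dim n si) :=
  let co := abscissae Ao in
  let ci := abscissae Ai in
  \mxcol_(l < n.+1) (co l 0 *: const_mx 1 + increment Ao l *: ci : 'cV[R]_si).

(* Main.v *)
Require Import Defs.
From HB Require Import structures.
From mathcomp Require Import all_boot all_order all_algebra.
From mathcomp Require Import all_classical all_reals all_analysis.
From mathcomp Require Import ring lra.

Import Order.TTheory GRing.Theory Num.Theory.
Import numFieldNormedType.Exports.

Local Open Scope ring_scope.

(** An MIS step advances the slow variable through the nodes of the outer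
    method, one internal step per interval between consecutive nodes.  Adding
    up these increments from the initial value turns every stage equation into
    a GARK stage equation: the slow increments a(k+1, j) - a(k, j) telescope to
    a row of the outer method, and the fast ones accumulate to the weights of
    the inner method scaled by the lengths of the intervals ([mis_gark]).
    Conversely the increments are the differences of the GARK equations.  The
    row sums of the tableau telescope in the same way and give internal
    consistency ([mis_Asf1], [mis_Afs1], [mis_Aff1]).

    Both order statements use the hypotheses on the inner and outer methods
    through quadrature conditions only.  A method of order p applied to
    u' = 1, v' = u^m integrates t^m over [0, H], so its weights and abscissae
    satisfy sum b_i c_i^m = 1 / (m + 1) for m < p ([rk_order_quadrature]).

    For second order, the weights of the fast part sum to 1 and their first
    moment is 1/2, because on each interval from x to x' the inner conditions
    yield (x'^2 - x^2) / 2, which telescopes ([sum_bf1], [sum_bf_cf]).  It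
    remains to see that an internally consistent method with these properties
    has local error O(H^3), even when its stages are implicit
    ([partitioned_order2]).  For small H the stage equations have a solution
    near the initial value by the contraction principle ([stages_exist]).  With
    J the derivative of the right-hand side F at y0, both the numerical and the
    exact solution equal y0 + H F(y0) + (H^2 / 2) J F(y0) + O(H^3)
    ([numerical_expansion], [exact_solution_expansion]); all that is used about
    the right-hand side is a Taylor estimate at y0 ([Ck2_local_model]).

    For third order, the telescoping above shows that the slow-fast product
    A^{sf} c^{f} is the vector of the co_k^2 / 2, so the first coupling
    condition is the outer quadrature condition for t^2 and always holds
    ([coupling_slow]).  In the other coupling sum the inner method enters only
    through its weights and first moment, which leaves one half of the right
    side of the announced condition ([coupling_fast]). *)

(** * The nodes of the outer method *)

Section Nodes.
Context {R : realType} {n : nat} (Ao : 'M[R]_n.+1).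

(** The abscissae of the outer method followed by the end point 1, so that
    every increment, including the last one, is a difference of consecutive
    values and sums of increments telescope. *)
Definition nodes (l : nat) : R :=
  if insub l is Some i then abscissae Ao i 0 else 1.

Lemma nodes_ord (l : 'I_n.+1) : nodes l = abscissae Ao l 0.
Proof. by rewrite /nodes valK. Qed.

Lemma nodes_last : nodes n.+1 = 1.
Proof. by rewrite /nodes insubF // ltnn. Qed.

(** Case split on blocks: all but the last one end at a slow stage, the last
    one ends at the new value. *)
Lemma ord_succP (P : 'I_n.+1 -> Prop) :
  (forall k : 'I_n, P (prv k)) -> P ord_max -> forall l, P l.
Proof. by move=> Pp Pm l; case: (unliftP ord_max l) => [k ->|->//];
exact: Pp. Qed.

Lemma val_prv (k : 'I_n) : prv k = k :> nat.
Proof. by rewrite /prv lift_max. Qed.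

Lemma val_nxt (k : 'I_n) : nxt k = k.+1 :> nat.
Proof. by []. Qed.

Lemma unlift_prv (k : 'I_n) : unlift ord_max (prv k) = Some k.
Proof. exact: liftK. Qed.

Lemma increment_prv (k : 'I_n) :
  increment Ao (prv k) = abscissae Ao (nxt k) 0 - abscissae Ao (prv k) 0.
Proof. by rewrite /increment unlift_prv. Qed.

Lemma increment_max : increment Ao ord_max = 1 - abscissae Ao ord_max 0.
Proof. by rewrite /increment unlift_none. Qed.

Lemma incrementE (l : 'I_n.+1) : increment Ao l = nodes l.+1 - nodes l.
Proof.
elim/ord_succP: l => [k|].
  by rewrite increment_prv -!nodes_ord val_nxt val_prv.
by rewrite increment_max -nodes_ord /= nodes_last.
Qed.

End Nodes.

Lemma sum_telescope_lt (V : zmodType) (n : nat) (g : nat -> V) (i : nat) :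
  (i <= n)%N -> \sum_(l < n | (l < i)%N) (g l.+1 - g l) = g i - g 0%N.
Proof.
move=> lein; rewrite -(big_ord_widen _ (fun l => g l.+1 - g l) lein).
by rewrite -(big_mkord xpredT (fun l => g l.+1 - g l)) telescope_sumr.
Qed.

(** * Entries and row sums of the fast blocks *)

Section FastIndex.
Context {n si : nat}.

Lemma sig1_Rank (l : 'I_n.+1) (q : 'I_si) :
  tagnat.sig1 (tagnat.Rank (p_ := fun _ => si) l q) = l.
Proof. exact: tagnat.Rank1K. Qed.

Lemma sig2_Rank (l : 'I_n.+1) (q : 'I_si) :
  tagnat.sig2 (tagnat.Rank (p_ := fun _ => si) l q) = q :> 'I_si.
Proof. by apply: val_inj; rewrite tagnat.Rank2K. Qed.

Lemma sum_fast (V : nmodType) (G : 'I_n.+1 -> 'I_si -> V) :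
  \sum_(j < fast_dim n si) G (tagnat.sig1 j) (tagnat.sig2 j) =
  \sum_l \sum_q G l q.
Proof.
rewrite sig_big_dep /= (reindex _ tagnat.sig_bij_on) /=.
by apply: eq_bigr.
Qed.

Lemma forall_fast (P : 'I_n.+1 -> 'I_si -> Prop) :
  (forall i : 'I_(fast_dim n si), P (tagnat.sig1 i) (tagnat.sig2 i)) <->
  (forall l q, P l q).
Proof.
split=> [Pi l q|Plq i]; last exact: Plq.
by have := Pi (tagnat.Rank l q); rewrite sig1_Rank sig2_Rank.
Qed.

End FastIndex.

Section Tableau.
Context {R : realType} {n si : nat}.
Variables (Ao : 'M[R]_n.+1) (bo : 'cV[R]_n.+1).
Variables (Ai : 'M[R]_si) (bi : 'cV[R]_si).
Local Notation co := (abscissae Ao).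
Local Notation ci := (abscissae Ai).

(** The row of outer coefficients that belongs to the end point of an internal
    ODE: the weights [bo] act as the row following the last stage. *)
Definition next_row (l : 'I_n.+1) : 'rV[R]_n.+1 :=
  if unlift ord_max l is Some k then row (nxt k) Ao else bo^T.

Lemma mis_AffE i j (l := tagnat.sig1 i) (m := tagnat.sig1 j)
    (q : 'I_si := tagnat.sig2 i) (r : 'I_si := tagnat.sig2 j) :
  mis_Aff Ao Ai bi i j =
  if (m < l)%N then increment Ao m * bi r 0
  else if m == l then increment Ao m * Ai q r else 0.
Proof.
rewrite mxE -/l -/m -/q -/r; case: ifP => _.
  by rewrite !mxE big_ord1 !mxE mul1r.
by case: ifP => _; rewrite mxE.
Qed.

Lemma mis_bfE i (l := tagnat.sig1 i) (q : 'I_si := tagnat.sig2 i) :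
  mis_bf Ao bi i 0 = increment Ao l * bi q 0.
Proof. by rewrite !mxE. Qed.

Lemma unitvTmul s (A : 'M[R]_(s, n.+1)) (k : 'I_s) :
  (unitv R k)^T *m A = row k A.
Proof. by rewrite /unitv trmx_delta -rowE. Qed.

Lemma mis_AfsE i j (l := tagnat.sig1 i) (q : 'I_si := tagnat.sig2 i) :
  mis_Afs Ao bo Ai i j = Ao l j + ci q 0 * (next_row l 0 j - Ao l j).
Proof.
rewrite mxE -/l -/q /next_row; clearbody l q; move: l; apply: ord_succP => [k|].
  rewrite unlift_prv linearB /= mulmxBl !unitvTmul !mxE !big_ord1 !mxE.
  by rewrite mul1r.
by rewrite unlift_none !unitvTmul !mxE !big_ord1 !mxE mul1r.
Qed.

Lemma mis_AsfE k j (l := tagnat.sig1 j) (q : 'I_si := tagnat.sig2 j) :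
  mis_Asf Ao bi k j = if (l < k)%N then increment Ao l * bi q 0 else 0.
Proof.
rewrite mxE -/l -/q; clearbody l q; move: l; apply: ord_succP => [m|].
  rewrite unlift_prv mxE !mxE big_ord1 !mxE val_prv val_nxt.
  by case: ifP => _; rewrite ?mul1r // mul0r mulr0.
by rewrite unlift_none mxE ltnNge -ltnS ltn_ord.
Qed.

Lemma mis_cfE i (l := tagnat.sig1 i) (q : 'I_si := tagnat.sig2 i) :
  mis_cf Ao Ai i 0 = co l 0 + increment Ao l * ci q 0.
Proof. by rewrite !mxE mulr1. Qed.

(** Every finished interval contributes the weighted sum of the inner method,
    the current one contributes the partial sum of the stage. *)
Lemma sum_Aff (V : lmodType R) (u : 'I_n.+1 -> 'I_si -> V) i
    (l := tagnat.sig1 i) (q : 'I_si := tagnat.sig2 i) :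
  \sum_j mis_Aff Ao Ai bi i j *: u (tagnat.sig1 j) (tagnat.sig2 j) =
  \sum_(m < n.+1 | (m < l)%N) increment Ao m *: (\sum_r bi r 0 *: u m r)
  + increment Ao l *: (\sum_r Ai q r *: u l r).
Proof.
under eq_bigr do rewrite mis_AffE.
rewrite (sum_fast _ (fun m r => (if (m < l)%N then increment Ao m * bi r 0
  else if m == l then increment Ao m * Ai q r else 0) *: u m r)).
rewrite (bigID (fun m : 'I_n.+1 => (m < l)%N)) /=; congr (_ + _).
  apply: eq_bigr => m ->; rewrite scaler_sumr.
  by apply: eq_bigr => r _; rewrite scalerA.
rewrite (bigD1 l) ?ltnn //= eqxx [X in _ + X]big1 ?addr0.
  by rewrite scaler_sumr; apply: eq_bigr => r _; rewrite scalerA.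
move=> m /andP[/negbTE-> /negbTE->].
by apply: big1 => r _; rewrite scale0r.
Qed.

Lemma sum_Asf (V : lmodType R) (u : 'I_n.+1 -> 'I_si -> V) k :
  \sum_j mis_Asf Ao bi k j *: u (tagnat.sig1 j) (tagnat.sig2 j) =
  \sum_(m < n.+1 | (m < k)%N) increment Ao m *: (\sum_r bi r 0 *: u m r).
Proof.
under eq_bigr do rewrite mis_AsfE.
rewrite (sum_fast _ (fun m r => (if (m < k)%N then increment Ao m * bi r 0
  else 0) *: u m r)) [RHS]big_mkcond /=.
apply: eq_bigr => m _; case: ifP => _.
    by rewrite scaler_sumr; apply: eq_bigr => r _; rewrite scalerA.
by apply: big1 => r _; rewrite scale0r.
Qed.

Lemma sum_bf (V : lmodType R) (u : 'I_n.+1 -> 'I_si -> V) :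
  \sum_j mis_bf Ao bi j 0 *: u (tagnat.sig1 j) (tagnat.sig2 j) =
  \sum_m increment Ao m *: (\sum_r bi r 0 *: u m r).
Proof.
under eq_bigr do rewrite mis_bfE.
rewrite (sum_fast _ (fun m r => (increment Ao m * bi r 0) *: u m r)).
apply: eq_bigr => m _.
by rewrite scaler_sumr; apply: eq_bigr => r _; rewrite scalerA.
Qed.

Lemma sum_Afs (V : lmodType R) (u : 'I_n.+1 -> V) i
    (l := tagnat.sig1 i) (q : 'I_si := tagnat.sig2 i) :
  \sum_j mis_Afs Ao bo Ai i j *: u j =
  \sum_j Ao l j *: u j
  + ci q 0 *: (\sum_j next_row l 0 j *: u j - \sum_j Ao l j *: u j).
Proof.
under eq_bigr do rewrite mis_AfsE scalerDl -scalerA scalerBl.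
by rewrite big_split /= -sumrB scaler_sumr.
Qed.

End Tableau.

(** * Internal consistency *)

Section Consistency.
Context {R : realType} {n si : nat}.
Variables (Ao : 'M[R]_n.+1) (bo : 'cV[R]_n.+1).
Variables (Ai : 'M[R]_si) (bi : 'cV[R]_si).
Local Notation co := (abscissae Ao).
Local Notation ci := (abscissae Ai).

Lemma abscissaeE s (A : 'M[R]_s) i : abscissae A i 0 = \sum_j A i j.
Proof. by rewrite mxE; apply: eq_bigr => j _; rewrite mxE mulr1. Qed.

Lemma mulmx1E s t (A : 'M[R]_(s, t)) i :
  (A *m (const_mx 1 : 'cV_t)) i 0 = \sum_j A i j.
Proof. by rewrite mxE; apply: eq_bigr => j _; rewrite mxE mulr1. Qed.

Lemma weight_sum s (b : 'cV[R]_s) :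
  (b^T *m (const_mx 1 : 'cV_s)) 0 0 = \sum_i b i 0.
Proof. by rewrite mulmx1E; apply: eq_bigr => i _; rewrite mxE. Qed.

Lemma sum_scale1 (I : finType) (u : I -> R) :
  \sum_j u j *: (1 : R^o) = \sum_j u j.
Proof. by apply: eq_bigr => j _; rewrite [_ *: _]mulr1. Qed.

Hypothesis co0 : co ord0 0 = 0.
Hypothesis bo1 : \sum_j bo j 0 = 1.
Hypothesis bi1 : \sum_j bi j 0 = 1.

Lemma nodes0 : nodes Ao 0 = 0.
Proof. by rewrite -co0 -nodes_ord. Qed.

Lemma sum_increment_lt (k : 'I_n.+1) :
  \sum_(m < n.+1 | (m < k)%N) increment Ao m = co k 0.
Proof.
under eq_bigr do rewrite incrementE.
by rewrite (sum_telescope_lt _ _ (nodes Ao)) ?nodes0 ?subr0 ?nodes_ord 1?ltnW.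
Qed.

Lemma next_row_sum l : \sum_j next_row Ao bo l 0 j = nodes Ao l.+1.
Proof.
move: l; rewrite /next_row; apply: ord_succP => [k|].
  rewrite unlift_prv val_prv -val_nxt nodes_ord abscissaeE.
  by apply: eq_bigr => j _; rewrite mxE.
by rewrite unlift_none nodes_last -bo1; apply: eq_bigr => j _; rewrite mxE.
Qed.

(** With constant right-hand sides equal to 1, the fast increments up to a slow
    stage add up to its abscissa. *)
Lemma mis_Asf1 : mis_Asf Ao bi *m const_mx 1 = co.
Proof.
apply/colP => k; rewrite mulmx1E.
under eq_bigr do rewrite -[mis_Asf _ _ _ _]mulr1.
rewrite (sum_Asf Ao bi R^o (fun _ _ => 1)) -sum_increment_lt.
apply: eq_bigr => m _.
by rewrite sum_scale1 bi1 [_ *: _]mulr1.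
Qed.

Lemma mis_Afs1 : mis_Afs Ao bo Ai *m const_mx 1 = mis_cf Ao Ai.
Proof.
apply/colP => i; rewrite mulmx1E mis_cfE.
under eq_bigr do rewrite -[mis_Afs _ _ _ _ _]mulr1.
rewrite (sum_Afs Ao bo Ai R^o (fun _ => 1)).
rewrite !sum_scale1 next_row_sum -(abscissaeE _ Ao).
by rewrite -nodes_ord -incrementE [_ *: _]mulrC.
Qed.

Lemma mis_Aff1 : mis_Aff Ao Ai bi *m const_mx 1 = mis_cf Ao Ai.
Proof.
apply/colP => i; rewrite mulmx1E mis_cfE.
under eq_bigr do rewrite -[mis_Aff _ _ _ _ _]mulr1.
rewrite (sum_Aff Ao Ai bi R^o (fun _ _ => 1)).
rewrite (sum_scale1 _ (Ai _)) -abscissaeE; congr (_ + _).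
rewrite -sum_increment_lt; apply: eq_bigr => m _.
by rewrite sum_scale1 bi1 [_ *: _]mulr1.
Qed.

End Consistency.

(** * MIS schemes as GARK methods *)

Section MisGark.
Context {R : realType} {n si d : nat}.
Variables (Ao : 'M[R]_n.+1) (bo : 'cV[R]_n.+1).
Variables (Ai : 'M[R]_si) (bi : 'cV[R]_si).
Hypothesis Ao_explicit : explicit_rk Ao.
Variables (fs ff : 'rV[R]_d -> 'rV[R]_d) (H : R) (y0 : 'rV[R]_d).
Variables (Ys : 'I_n.+1 -> 'rV[R]_d) (Yf : 'I_n.+1 -> 'I_si -> 'rV[R]_d).
Variable (y1 : 'rV[R]_d).

Let P l := \sum_j Ao l j *: fs (Ys j).
Let N l := \sum_j next_row Ao bo l 0 j *: fs (Ys j).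
Let phi l := \sum_q bi q 0 *: ff (Yf l q).
Let T (l : nat) : 'rV[R]_d :=
  \sum_(m < n.+1 | (m < l)%N) increment Ao m *: phi m.

(** This makes the GARK equation of the first slow stage read [Ys ord0 = y0]. *)
Lemma row0_explicit : P ord0 = 0.
Proof. by apply: big1 => j _; rewrite Ao_explicit // scale0r. Qed.

Lemma next_row_prv k : N (prv k) = P (nxt k).
Proof.
by apply: eq_bigr => j _; rewrite /next_row unlift_prv mxE.
Qed.

Lemma next_row_max : N ord_max = \sum_j bo j 0 *: fs (Ys j).
Proof.
by apply: eq_bigr => j _; rewrite /next_row unlift_none mxE.
Qed.

(** Explicitness removes the terms beyond the current stage, so the truncated
    sum is the difference of two full rows. *)
Lemma slow_prv (k : 'I_n) :
  \sum_(j < n.+1 | (j < nxt k)%N) (Ao (nxt k) j - Ao (prv k) j) *: fs (Ys j)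
  = N (prv k) - P (prv k).
Proof.
rewrite next_row_prv -sumrB big_mkcond; apply: eq_bigr => j _ /=.
case: ltnP => [_|le]; first by rewrite scalerBl.
by rewrite !Ao_explicit ?scale0r ?subr0 // val_prv; apply: leq_trans le.
Qed.

Lemma slow_max :
  \sum_j (bo j 0 - Ao ord_max j) *: fs (Ys j) = N ord_max - P ord_max.
Proof.
rewrite next_row_max -sumrB.
by apply: eq_bigr => j _; rewrite scalerBl.
Qed.

Lemma fast_sumS (l : 'I_n.+1) : T l.+1 = T l + increment Ao l *: phi l.
Proof.
rewrite /T [RHS]addrC [LHS](bigD1 l) //=; congr (_ + _); apply: eq_bigl => m.
by rewrite ltnS leq_eqVlt -val_eqE; case: ltngtP.
Qed.

Lemma fast_sum_all : T n.+1 = \sum_m increment Ao m *: phi m.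
Proof. by apply: eq_bigl => m; rewrite ltn_ord. Qed.

(** In block form the sum [T l] of the fast increments before block [l] and the
    slow row [P l] are shared by the slow stage [l] and the fast stages of block
    [l]: a fast stage starts from the slow stage of its block. *)
Lemma gark_stepE :
  gark_step (mis_Aff Ao Ai bi) (mis_Afs Ao bo Ai) (mis_Asf Ao bi) Ao
    (mis_bf Ao bi) bo ff fs H y0
    (fun i => Yf (tagnat.sig1 i) (tagnat.sig2 i)) Ys y1 <->
  [/\ forall l q, Yf l q = y0 + H *: (T l + P l)
        + (H * abscissae Ai q 0) *: (N l - P l)
        + (H * increment Ao l) *: \sum_r Ai q r *: ff (Yf l r),
      forall l, Ys l = y0 + H *: (T l + P l)
    & y1 = y0 + H *: (T n.+1 + N ord_max)].
Proof.
pose fY l q := ff (Yf l q).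
have Ef q (l : 'I_n.+1) :
  y0 + H *: (T l + increment Ao l *: (\sum_r Ai q r *: ff (Yf l r))
    + (P l + abscissae Ai q 0 *: (N l - P l))) =
  y0 + H *: (T l + P l) + (H * abscissae Ai q 0) *: (N l - P l)
        + (H * increment Ao l) *: \sum_r Ai q r *: ff (Yf l r).
  rewrite -!scalerA -!addrA -!scalerDr -!addrA; congr (_ + _ *: (_ + _)).
  by rewrite addrC -addrA.
split=> [[Hf Hs Hy]|[Hf Hs Hy]]; split.
- apply/forall_fast => i; rewrite Hf.
  by rewrite (sum_Aff _ _ _ _ fY) sum_Afs -/(P _) -/(N _) -Ef.
- by move=> l; rewrite Hs (sum_Asf _ _ _ fY).
- by rewrite Hy (sum_bf _ _ _ fY) fast_sum_all next_row_max.
- by move=> i; rewrite Hf (sum_Aff _ _ _ _ fY) sum_Afs -/(P _) -/(N _) -Ef.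
- by move=> l; rewrite Hs (sum_Asf _ _ _ fY).
- by rewrite Hy (sum_bf _ _ _ fY) fast_sum_all next_row_max.
Qed.

Lemma mis_stepE :
  mis_step Ao bo Ai bi fs ff H y0 Ys Yf y1 <->
  [/\ Ys ord0 = y0,
      forall l q, Yf l q = Ys l + (H * abscissae Ai q 0) *: (N l - P l)
        + (H * increment Ao l) *: \sum_r Ai q r *: ff (Yf l r),
      forall k : 'I_n, Ys (nxt k) = Ys (prv k)
        + H *: (N (prv k) - P (prv k) + increment Ao (prv k) *: phi (prv k))
    & y1 = Ys ord_max
        + H *: (N ord_max - P ord_max + increment Ao ord_max *: phi ord_max)].
Proof.
rewrite /mis_step slow_max; split.
- case=> H0 Hf Hs Hm Hy; split=> //.
  + by apply: ord_succP => [k|] q; rewrite (Hf, Hm) ?slow_prv;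
      rewrite (increment_prv, increment_max).
  + move=> k; rewrite Hs slow_prv -increment_prv.
    by rewrite -addrA -scalerA -scalerDr.
  + by rewrite Hy -increment_max -addrA -scalerA -scalerDr.
- case=> H0 Hf Hs Hy; split=> //.
  + by move=> k q; rewrite Hf slow_prv increment_prv.
  + move=> k; rewrite Hs slow_prv increment_prv.
    by rewrite -[in RHS]addrA -[in RHS]scalerA -scalerDr.
  + by move=> q; rewrite Hf increment_max.
  + by rewrite Hy -increment_max -[in RHS]addrA -[in RHS]scalerA -scalerDr.
Qed.

Lemma mis_gark :
  mis_step Ao bo Ai bi fs ff H y0 Ys Yf y1 <->
  gark_step (mis_Aff Ao Ai bi) (mis_Afs Ao bo Ai) (mis_Asf Ao bi) Ao
    (mis_bf Ao bi) bo ff fs H y0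
    (fun i => Yf (tagnat.sig1 i) (tagnat.sig2 i)) Ys y1.
Proof.
rewrite gark_stepE mis_stepE.
(* One internal ODE moves the accumulated sum from the row of its initial
   point to the row of its end point. *)
have step (l : 'I_n.+1) : H *: (T l.+1 + N l) =
    H *: (T l + P l) + H *: (N l - P l + increment Ao l *: phi l).
  rewrite -scalerDr fast_sumS; congr (_ *: _).
  by rewrite [N l - _ + _]addrC addrACA [P l + _]addrC subrK.
have T0 : T 0 = 0 by apply: big_pred0.
split=> [[H0 Hf Hs Hy]|[Hf Hs Hy]].
- have Ys_sum l : Ys l = y0 + H *: (T l + P l).
    case: l => l; elim: l => [|l IH] ltl.
      have -> : Ordinal ltl = ord0 by apply: val_inj.
      by rewrite T0 row0_explicit addr0 scaler0 addr0.
    have -> : Ordinal ltl = nxt (Ordinal (ltl : (l < n)%N)) by apply: val_inj.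
    set k := Ordinal _; have Ek : prv k = Ordinal (ltnW ltl).
      by apply: val_inj; exact: val_prv.
    have valk : prv k = l :> nat by exact: val_prv.
    rewrite Hs {1}Ek IH -Ek.
    have -> : T (nxt k) = T (prv k).+1 by rewrite valk.
    by rewrite -addrA -step next_row_prv.
  split=> //; first by move=> l q; rewrite Hf Ys_sum.
  by rewrite Hy Ys_sum -addrA -step.
- split.
  + by rewrite Hs T0 row0_explicit addr0 scaler0 addr0.
  + by move=> l q; rewrite Hf -Hs.
  + by move=> k; rewrite !Hs -addrA -step val_prv next_row_prv.
  + by rewrite Hy Hs -addrA -step.
Qed.

End MisGark.

(** * Second and third order sums of the tableau *)

Section Coupling.
Context {R : realType} {n si : nat}.
Variables (Ao : 'M[R]_n.+1) (bo : 'cV[R]_n.+1).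
Variables (Ai : 'M[R]_si) (bi : 'cV[R]_si).
Local Notation co := (abscissae Ao).
Local Notation ci := (abscissae Ai).
Hypothesis co0 : co ord0 0 = 0.
Hypothesis bi1 : \sum_j bi j 0 = 1.

Lemma sum_bf1 : \sum_j mis_bf Ao bi j 0 = 1.
Proof.
under eq_bigr do rewrite -[mis_bf _ _ _ _]mulr1.
rewrite (sum_bf Ao bi R^o (fun _ _ => 1)) sum_scale1 bi1 sum_scale1.
under eq_bigl => m do rewrite -[true](ltn_ord m).
under eq_bigr do rewrite incrementE.
by rewrite (sum_telescope_lt _ _ (nodes Ao)) // nodes_last nodes0 ?subr0.
Qed.

Hypothesis bici : \sum_j bi j 0 * ci j 0 = 1 / 2%:R.

(** On the interval from x to x' an inner method with sum of weights 1 and first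
    moment 1/2 integrates t exactly, giving (x'^2 - x^2) / 2. *)
Lemma fast_moment (m : 'I_n.+1) :
  increment Ao m * \sum_r bi r 0 * (co m 0 + increment Ao m * ci r 0) =
  nodes Ao m.+1 ^+ 2 / 2%:R - nodes Ao m ^+ 2 / 2%:R.
Proof.
under eq_bigr do rewrite mulrDr mulrCA.
rewrite big_split /= -mulr_suml -mulr_sumr bici bi1 -nodes_ord incrementE.
by field.
Qed.

Lemma mis_Asf_cf k : (mis_Asf Ao bi *m mis_cf Ao Ai) k 0 = co k 0 ^+ 2 / 2%:R.
Proof.
rewrite mxE; under eq_bigr do rewrite mis_cfE.
rewrite (sum_Asf Ao bi R^o (fun l q => co l 0 + increment Ao l * ci q 0)).
under eq_bigr do rewrite [_ *: _]fast_moment.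
rewrite (sum_telescope_lt _ _ (fun l => nodes Ao l ^+ 2 / 2%:R)) 1?ltnW //.
by rewrite nodes0 // expr0n mul0r subr0 nodes_ord.
Qed.

Lemma sum_bf_cf : \sum_j mis_bf Ao bi j 0 * mis_cf Ao Ai j 0 = 1 / 2%:R.
Proof.
under eq_bigr do rewrite mis_cfE.
rewrite (sum_bf Ao bi R^o (fun l q => co l 0 + increment Ao l * ci q 0)).
under eq_bigr do rewrite [_ *: _]fast_moment.
under eq_bigl => m do rewrite -[true](ltn_ord m).
rewrite (sum_telescope_lt _ _ (fun l => nodes Ao l ^+ 2 / 2%:R)) //.
by rewrite nodes0 // expr0n mul0r subr0 nodes_last expr1n.
Qed.

Lemma coupling_slow : \sum_j bo j 0 * co j 0 ^+ 2 = 1 / 3%:R ->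
  (bo^T *m mis_Asf Ao bi *m mis_cf Ao Ai) 0 0 = 1 / 6%:R.
Proof.
move=> boco2; rewrite -mulmxA mxE.
under eq_bigr do rewrite mis_Asf_cf mxE mulrA.
by rewrite -mulr_suml boco2; field.
Qed.

Hypothesis boco : \sum_j bo j 0 * co j 0 = 1 / 2%:R.

(** In the block of an internal ODE the weights average the values of A^o c^o at
    its two end points, as the trapezoidal rule does; at the end point 1 this
    value is replaced by the first moment 1/2 of the outer weights. *)
Lemma coupling_fast :
  ((mis_bf Ao bi)^T *m mis_Afs Ao bo Ai *m co) 0 0 =
  (\sum_(k < n) (co (nxt k) 0 - co (prv k) 0) *
           ((unitv R (nxt k) + unitv R (prv k))^T *m Ao *m co) 0 0
        + (1 - co ord_max 0) *
          (1 / 2%:R + ((unitv R ord_max)^T *m Ao *m co) 0 0)) / 2%:R.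
Proof.
pose w l := (Ao *m co) l 0.
pose v l := (next_row Ao bo l *m co) 0 0.
have unitvE k : ((unitv R k)^T *m Ao *m co) 0 0 = w k.
  by rewrite unitvTmul mxE [RHS]mxE; apply: eq_bigr => j _; rewrite mxE.
have vprv k : v (prv k) = w (nxt k).
  rewrite /v /next_row unlift_prv mxE [RHS]mxE.
  by apply: eq_bigr => j _; rewrite mxE.
have vmax : v ord_max = 1 / 2%:R.
  rewrite /v /next_row unlift_none mxE -boco.
  by apply: eq_bigr => j _; rewrite mxE.
rewrite -mulmxA mxE.
transitivity (\sum_l increment Ao l * ((w l + v l) / 2%:R)).
  under eq_bigr => j _.
    rewrite mxE [(_ *m co) j 0]mxE.
    rewrite (sum_Afs Ao bo Ai R^o (fun j => co j 0)).
    over.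
  pose u l q : R^o := w l + ci q 0 * (v l - w l).
  transitivity (\sum_j mis_bf Ao bi j 0 *: u (tagnat.sig1 j) (tagnat.sig2 j)).
    by apply: eq_bigr => j _; rewrite /u /w /v !mxE.
  rewrite (sum_bf Ao bi); apply: eq_bigr => m _; congr (_ * _).
  under eq_bigr do rewrite /u [_ *: _]mulrDr mulrA.
  by rewrite big_split /= -!mulr_suml bici bi1; field.
rewrite big_ord_recr /= [RHS]mulrDl mulr_suml; congr (_ + _).
  apply: eq_bigr => k _.
  have -> : widen_ord (leqnSn n) k = prv k.
    by apply: val_inj; apply: esym; exact: val_prv.
  have -> : ((unitv R (nxt k) + unitv R (prv k))^T *m Ao *m co) 0 0 =
      w (nxt k) + w (prv k).
    by rewrite linearD /= !mulmxDl mxE !unitvE.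
  rewrite vprv increment_prv.
  by rewrite mulrA [w _ + w _]addrC.
by rewrite unitvE vmax increment_max mulrA [w _ + _]addrC.
Qed.

End Coupling.

(** * Mean value estimates for row vectors *)

Section VectorEstimates.
Context {R : realType} {d : nat}.
Local Notation V := 'rV[R]_d.
Local Open Scope classical_set_scope.

Lemma rV_norm_le (u : V) (B : R) :
  0 <= B -> (forall j, `|u 0 j| <= B) -> `|u| <= B.
Proof.
move=> B0 uB; rewrite [leLHS]/Num.Def.normr /= mx_normrE.
by apply: bigmax_le => // -[i j] _ /=; rewrite ord1.
Qed.

Lemma rV_coord_le (u : V) j : `|u 0 j| <= `|u|.
Proof.
rewrite [leRHS]/Num.Def.normr /= mx_normrE.
exact: (le_bigmax _ (fun ij : 'I_1 * 'I_d => `|u ij.1 ij.2|) (0, j)).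
Qed.

Lemma is_derive_coord (g : R -> V) (t : R) (l : V) j :
  is_derive t 1 g l -> is_derive t 1 (fun s => g s 0 j) (l 0 j).
Proof.
move=> [dg gl]; split; first exact: (derivable_mxP g t 1).1.
by rewrite -gl (derive_mx dg) mxE.
Qed.

(** The mean value theorem fails for vector-valued functions, but the norm is a
    maximum over coordinates, so the inequality follows coordinatewise. *)
Lemma mean_value_bound (g dg : R -> V) (h M : R) : 0 <= h ->
  (forall t, 0 <= t <= h -> is_derive t 1 g (dg t)) ->
  (forall t, 0 <= t <= h -> `|dg t| <= M) ->
  `|g h - g 0| <= M * h.
Proof.
move=> h0 gdg dgM.
have M0 : 0 <= M by apply: le_trans (dgM 0 _) => //; rewrite lexx.
apply: rV_norm_le => [|j]; first exact: mulr_ge0.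
have dgj t : 0 <= t <= h -> is_derive t 1 (fun s => g s 0 j) (dg t 0 j).
  by move=> /gdg; exact: is_derive_coord.
have [t th| |t] := @MVT_segment _ (fun s => g s 0 j) (fun s => dg s 0 j) 0 h h0.
- apply: dgj; move: th; rewrite in_itv /= => /andP[a b].
  by rewrite !ltW.
- apply: derivable_within_continuous => t th.
  by have [] := dgj t th.
rewrite in_itv /= => th; rewrite !mxE => ->.
rewrite subr0 normrM (ger0_norm h0) ler_wpM2r //.
exact: le_trans (rV_coord_le _ _) (dgM _ th).
Qed.

Lemma is_derive_line (f : V -> V) (x v : V) (t : R) (l : V) :
  is_derive (x + t *: v) v f l ->
  is_derive t 1 (fun s : R => f (x + s *: v)) l.
Proof.
have E : (fun h : R => h^-1 *: ((f \o shift (x + t *: v)) (h *: v)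
      - f (x + t *: v))) =
    (fun h : R => h^-1 *: (((fun s : R => f (x + s *: v)) \o shift t) (h *: 1)
      - f (x + t *: v))).
  apply/funext => h /=; congr (_ *: (f _ - _)).
  by rewrite [h *: 1]mulr1 scalerDl addrCA.
by move=> [df fl]; split; rewrite /derivable /derive -?E.
Qed.

(** Taking [w = 0] gives Lipschitz bounds, and [w] the derivative at [x] gives
    Taylor estimates. *)
Lemma segment_bound (f : V -> V) (x v w : V) (M : R) :
  (forall z, differentiable f z) ->
  (forall t, 0 <= t <= 1 -> `|'D_v f (x + t *: v) - w| <= M) ->
  `|f (x + v) - f x - w| <= M.
Proof.
move=> df fM.
pose g (t : R) := f (x + t *: v) - t *: w.
have -> : f (x + v) - f x - w = g 1 - g 0.
  by rewrite /g scale1r scale0r addr0 scale0r scale1r subr0 addrAC.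
rewrite -[M]mulr1.
apply: (@mean_value_bound g (fun t => 'D_v f (x + t *: v) - w)) => // t t01.
have fl : is_derive t 1 (fun s : R => f (x + s *: v)) ('D_v f (x + t *: v)).
  by apply: is_derive_line; apply: derivableP; exact: diff_derivable.
have wl : is_derive t (1 : R) ( *:%R ^~ w : R -> V) w.
  split; first by apply: diff_derivable; exact: ex_diff.
  by rewrite deriveE; [rewrite diff_val scale1r|exact: ex_diff].
exact: is_deriveB.
Qed.

(** Reduces bounds uniform in the direction to the finitely many partial
    derivatives. *)
Lemma derive_delta_sum (f : V -> V) (x v : V) : differentiable f x ->
  'D_v f x = \sum_j v 0 j *: 'D_(delta_mx 0 j) f x.
Proof.
move=> df; rewrite deriveE // {1}[v]row_sum_delta linear_sum.
by apply: eq_bigr => j _; rewrite linearZ deriveE.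
Qed.

Lemma differentiable_growth (f : V -> V) (x : V) : differentiable f x ->
  exists K : R, 0 <= K /\ \forall z \near x, `|f z - f x| <= K * `|z - x|.
Proof.
move=> df.
have dfc : continuous ('d f x) by exact: diff_continuous.
have [k k0 fk] := linear_lipschitz dfc.
exists (k + 1); split; first by rewrite addr_ge0 // ltW.
have /eqaddoP/(_ 1 ltr01) fo := diff_locally df.
rewrite (near_shift 0) subr0; near=> h.
have /= : `|(f \o shift x - (cst (f x) + 'd f x)) h| <= 1 * `|h|.
  by near: h; exact: fo.
rewrite mul1r /= => foh.
rewrite addrK -[f (h + x) - f x](subrK ('d f x h)).
rewrite (le_trans (ler_normD _ _)) // addrC mulrDl mul1r lerD //.
by move: foh; rewrite !fctE /= opprD addrA.
Unshelve. all: by end_near. Qed.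

End VectorEstimates.

(** * Quadrature conditions implied by the order of a method *)

Section PolynomialField.
Context {R : realType} {d : nat}.
Local Notation V := 'rV[R]_d.+1.
Local Open Scope classical_set_scope.

(** Polynomials in the first coordinate suffice for the test problems; they are
    stable under directional derivatives, hence of class C^N for every N. *)
Definition poly_field (e : nat) (p : 'I_e -> {poly R}) (x : V) : 'rV[R]_e :=
  \row_j (p j).[x 0 0].

Lemma is_diff_horner_coord (p : {poly R}) (x : V) :
  is_diff x (fun z : V => p.[z 0 0]) (fun v => v 0 0 * p^`().[x 0 0]).
Proof.
have cd : differentiable (fun z : V => z 0 0 : R) x.
  exact: differentiable_coord.
have pd : differentiable (horner p) (x 0 0).
  by apply/derivable1_diffP; exact: derivable_horner.
split; first exact: (differentiable_comp cd pd).
apply/funext => v.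
rewrite (diff_comp cd pd) /= deriv1E; last exact: derivable_horner.
rewrite -derivE /=; congr (_ * _); rewrite -deriveE //.
have := derive_mx (@derivable_id R V x v).
by rewrite derive_id => /rowP/(_ 0); rewrite mxE => ->.
Qed.

Lemma differentiable_row e (g : V -> 'rV[R]_e) x :
  (forall j, differentiable (fun z => g z 0 j) x) -> differentiable g x.
Proof.
move=> dg.
have -> : g = \sum_j (fun z => g z 0 j *: delta_mx 0 j : 'rV[R]_e).
  by apply/funext => z; rewrite fct_sumE [LHS]row_sum_delta.
by apply: differentiable_sum => j; exact: differentiableZl.
Qed.

Lemma differentiable_poly_field e (p : 'I_e -> {poly R}) x :
  differentiable (poly_field e p) x.
Proof.
apply: differentiable_row => j.
have -> : (fun z => poly_field e p z 0 j) = (fun z : V => (p j).[z 0 0]).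
  by apply/funext => z; rewrite mxE.
by have [] := is_diff_horner_coord (p j) x.
Qed.

Lemma derive_poly_field e (p : 'I_e -> {poly R}) v :
  (fun x => 'D_v (poly_field e p) x) =
  poly_field e (fun j => v 0 0 *: (p j)^`()).
Proof.
apply/funext => x; rewrite derive_mx; last first.
  by apply: diff_derivable; exact: differentiable_poly_field.
apply/rowP => j; rewrite !mxE.
have -> : (fun z => poly_field e p z 0 j) = (fun z : V => (p j).[z 0 0]).
  by apply/funext => z; rewrite mxE.
have [dp dpE] := is_diff_horner_coord (p j) x.
by rewrite deriveE // dpE hornerZ.
Qed.

Lemma Ck_poly_field e N (p : 'I_e -> {poly R}) : Ck N (poly_field e p).
Proof.
elim: N p => [|N IH] p.
  move=> x; apply: differentiable_continuous.
  exact: differentiable_poly_field.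
split; first exact: differentiable_poly_field.
by move=> v; rewrite derive_poly_field.
Qed.

Lemma is_derive_poly_curve e (q : 'I_e -> {poly R}) (t : R) :
  is_derive t (1 : R) (fun s : R => \row_j (q j).[s]) (\row_j (q j)^`().[t]).
Proof.
have E j : (fun s : R => (\row_j (q j).[s] : 'rV[R]_e) 0 j) = horner (q j).
  by apply/funext => s; rewrite mxE.
have dq : derivable (fun s : R => \row_j (q j).[s] : 'rV[R]_e) t 1.
  apply/derivable_mxP => i j; rewrite ord1 E; exact: derivable_horner.
split=> //; rewrite derive_mx //; apply/rowP => j.
by rewrite !mxE E -derive1E derivE.
Qed.

End PolynomialField.

Section OrderConditions.
Context {R : realType} {s : nat}.
Local Open Scope classical_set_scope.

(** On u' = 1, v' = u^m with zero initial value the stages have u-component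
    H c_i, whatever the method, and the v-component of the step is H^(m+1) times
    the quadrature sum; the exact value is H^(m+1) / (m+1).  As m + 1 <= p, an
    error O(H^(p+1)) forces the two factors to agree. *)
Lemma rk_order_quadrature (p m : nat) (A : 'M[R]_s) (b : 'cV[R]_s) :
  (m < p)%N -> rk_order p A b ->
  \sum_i b i 0 * abscissae A i 0 ^+ m = 1 / m.+1%:R.
Proof.
move=> mp [N ord].
pose rhs (j : 'I_2) : {poly R} := if j == 0 then 1 else 'X^m.
pose f := poly_field (d := 1) 2 rhs.
pose sol (j : 'I_2) : {poly R} :=
  if j == 0 then 'X else (m.+1%:R^-1 : R) *: 'X^(m.+1).
pose y (t : R) : 'rV[R]_2 := \row_j (sol j).[t].
have f0 x : f x 0 0 = 1 by rewrite mxE /rhs eqxx hornerC.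
have f1 x : f x 0 1 = x 0 0 ^+ m by rewrite mxE /rhs /= hornerXn.
have ysol : ode_solution f 0 1 y.
  split.
    apply/rowP => j; rewrite !mxE /sol; case: ifP => _; rewrite !hornerE //.
    by rewrite expr0n mulr0.
  move=> t _; have -> : f (y t) = \row_j (sol j)^`().[t].
    apply/rowP => j; rewrite !mxE /rhs /sol /=; case: ifP => _.
      by rewrite derivX !hornerC.
    rewrite derivZ derivXn /= hornerZ hornerMn !hornerXn mulrnAr -mulrnAl.
    by rewrite hornerX -[_ *+ _]mulr_natl divff ?mul1r ?pnatr_eq0.
  exact: is_derive_poly_curve.
have [r [C [r0 near_h]]] := ord _ f (Ck_poly_field 2 N rhs) 0 1 y ltr01 ysol.
set S := \sum_i _; apply/eqP; rewrite -subr_eq0 -normr_eq0; apply/negPn/negP.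
move=> /negPf D0; set D := `|_| in D0.
have {}D0 : 0 < D by rewrite lt_neqAle eq_sym D0 normr_ge0.
near (0 : R)^'+ => h.
have h0 : 0 < h by [].
have [[Y [y1 [st Yr]]] bound] : (exists Y y1, rk_step A b f h 0 Y y1 /\
      (forall i, `|Y i - 0| < r)) /\
    (forall Y y1, rk_step A b f h 0 Y y1 -> (forall i, `|Y i - 0| < r) ->
      `|y1 - y h| <= C * h ^+ p.+1).
  by near: h; exact: near_h.
have {bound}bound := bound _ _ st Yr; case: st => stY sty.
have Y0 i : Y i 0 0 = h * abscissae A i 0.
  rewrite stY !mxE add0r summxE; congr (_ * _); apply: eq_bigr => j _.
  by rewrite [LHS]mxE f0 [in RHS]mxE.
have y11 : y1 0 1 = h ^+ m.+1 * S.
  rewrite sty !mxE add0r summxE exprS -mulrA; congr (_ * _).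
  rewrite /S mulr_sumr.
  by apply: eq_bigr => i _; rewrite mxE f1 Y0 exprMn mulrCA.
have yh1 : y h 0 1 = h ^+ m.+1 / m.+1%:R.
  by rewrite mxE /sol /= hornerZ hornerXn mulrC.
have h1 : h <= 1 by near: h; exact: nbhs_right_ltW.
have hD : h < D / (`|C| + 1).
  by near: h; apply: nbhs_right_lt; rewrite divr_gt0 // ltr_wpDl.
have : h ^+ m.+1 * D <= h ^+ m.+1 * (`|C| * h).
  have -> : h ^+ m.+1 * D = `|(y1 - y h) 0 1|.
    rewrite mxE y11 mxE yh1 -mulrBr normrM ger0_norm ?exprn_ge0 1?ltW //.
    by rewrite /D mul1r.
  apply: le_trans (rV_coord_le _ _) _; apply: le_trans bound _.
  rewrite mulrCA -exprSr; apply: le_trans (_ : `|C| * h ^+ p.+1 <= _).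
    by rewrite ler_wpM2r ?ler_norm // exprn_ge0 // ltW.
  rewrite ler_wpM2l //; by apply: ler_wiXn2l => //; exact: ltW.
rewrite ler_pM2l ?exprn_gt0 // => DC.
move: hD; rewrite ltr_pdivlMr ?ltr_wpDl // mulrDr mulr1 mulrC.
by move=> /lt_le_trans/(_ DC); rewrite ltNge lerDl ltW.
Unshelve. all: by end_near. Qed.
End OrderConditions.

(** * First order Taylor models of a vector field *)

Section LocalModel.
Context {R : realType} {d : nat}.
Local Notation V := 'rV[R]_d.
Local Open Scope classical_set_scope.

(** [J] acts on row vectors from the right, as the Jacobian matrix of [f] at
    [y0] does.  These bounds are all that the error analysis uses about a smooth
    vector field; unlike differentiability they come with explicit constants,
    uniform on a ball. *)
Definition local_model (f : V -> V) (y0 : V) (J : 'M[R]_d) (r L : R) : Prop :=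
  [/\ forall x z, `|x - y0| < r -> `|z - y0| < r ->
        `|f x - f z| <= L * `|x - z|,
      forall v : V, `|v *m J| <= L * `|v|,
      `|f y0| <= L
    & forall x, `|x - y0| < r ->
        `|f x - f y0 - (x - y0) *m J| <= L * `|x - y0| ^+ 2].

Lemma local_model_weaken f y0 J r L r' L' : r' <= r -> L <= L' ->
  local_model f y0 J r L -> local_model f y0 J r' L'.
Proof.
move=> rr' LL' [lip linb val tay]; split.
- move=> x z xr zr; have := lip _ _ (lt_le_trans xr rr') (lt_le_trans zr rr').
  by move/le_trans; apply; rewrite ler_wpM2r.
- by move=> v; apply: le_trans (linb v) _; rewrite ler_wpM2r.
- exact: le_trans LL'.
- move=> x xr; apply: le_trans (tay x (lt_le_trans xr rr')) _.
  by rewrite ler_wpM2r // exprn_ge0.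
Qed.

Lemma ball_convex (y0 x v : V) (r t : R) : 0 <= t <= 1 ->
  `|x - y0| < r -> `|x + v - y0| < r -> `|x + t *: v - y0| < r.
Proof.
move=> /andP[t0 t1] xr xvr.
have -> : x + t *: v - y0 = (1 - t) *: (x - y0) + t *: (x + v - y0).
  rewrite scalerBl scale1r addrAC [x + v - y0]addrAC [t *: (_ + v)]scalerDr.
  by rewrite addrA subrK.
apply: le_lt_trans (ler_normD _ _) _; rewrite !normrZ (ger0_norm t0).
rewrite ger0_norm ?subr_ge0 //.
have [->|t_neq0] := eqVneq t 0; first by rewrite subr0 mul1r mul0r addr0.
have tp : 0 < t by rewrite lt_neqAle eq_sym t_neq0.
have -> : r = (1 - t) * r + t * r by rewrite mulrBl mul1r subrK.
by rewrite ler_ltD // ?ltr_pM2l // ler_wpM2l ?subr_ge0 // ltW.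
Qed.

(** The partial derivatives g_j of f are differentiable at [y0], so they deviate
    from their values at [y0] by O(|z - y0|); integrating along segments gives
    the Lipschitz bound and the quadratic Taylor remainder. *)
Lemma Ck2_local_model (f : V -> V) (y0 : V) : Ck 2 f ->
  exists r L, 0 < r /\ local_model f y0 (jacobian f y0) r L.
Proof.
move=> [df d2f]; pose g j := 'D_(delta_mx 0 j) f.
have dg j : differentiable (g j) y0 by have [] := d2f (delta_mx 0 j).
have [K KP] := choice (fun j => differentiable_growth _ _ (dg j)).
have K0 j : 0 <= K j by have [] := KP j.
pose S := \sum_j K j.
have S0 : 0 <= S by apply: sumr_ge0.
have KS j : K j <= S by rewrite /S (bigD1 j) //= lerDl sumr_ge0.
have /nbhs_normP[r /= r0 Hr] :
    \forall z \near y0, forall j, `|g j z - g j y0| <= K j * `|z - y0|.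
  have FF : Filter (nbhs y0) by exact: nbhs_filter.
  by apply: (filter_forall FF) => j; have [] := KP j.
pose G := \sum_j `|g j y0|.
have G0 : 0 <= G by apply: sumr_ge0.
pose D := d%:R * S.
have D0 : 0 <= D by rewrite mulr_ge0.
have derb (v z : V) : `|z - y0| < r ->
    `|'D_v f z - 'D_v f y0| <= D * `|v| * `|z - y0|.
  move=> zr; rewrite (derive_delta_sum f z) // (derive_delta_sum f y0) //.
  rewrite -sumrB; apply: le_trans (ler_norm_sum _ _ _) _.
  apply: (@le_trans _ _ (\sum_(j < d) (`|v| * (S * `|z - y0|)))).
    apply: ler_sum => j _; rewrite -scalerBr normrZ.
    apply: ler_pM => //; first exact: rV_coord_le.
    apply: le_trans (Hr z _ j) _; first by rewrite /ball_/= distrC.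
    by rewrite ler_wpM2r.
  rewrite sumr_const card_ord -mulr_natl /D.
  by rewrite -!mulrA ler_wpM2l // mulrCA.
have der0 (v : V) : `|'D_v f y0| <= G * `|v|.
  rewrite (derive_delta_sum f y0) //; apply: le_trans (ler_norm_sum _ _ _) _.
  rewrite /G mulr_suml; apply: ler_sum => j _; rewrite normrZ mulrC.
  by rewrite ler_wpM2l // rV_coord_le.
pose L := G + D * r + `|f y0| + D.
have r0' := ltW r0.
have Dr0 : 0 <= D * r by rewrite mulr_ge0.
have f0 : 0 <= `|f y0| by [].
exists r, L; split=> //; split.
- move=> x z xr zr.
  have := @segment_bound _ _ f z (x - z) 0 (L * `|x - z|) df.
  rewrite [z + _]addrC subrK subr0; apply=> t t01; rewrite subr0.
  have wr : `|z + t *: (x - z) - y0| < r.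
    by apply: ball_convex => //; rewrite [z + _]addrC subrK.
  rewrite -['D_(x - z) f _](subrK ('D_(x - z) f y0)).
  apply: le_trans (ler_normD _ _) _.
  apply: le_trans (lerD (derb _ _ wr) (der0 _)) _.
  rewrite mulrAC -mulrDl ler_wpM2r //.
  have : D * `|z + t *: (x - z) - y0| <= D * r by rewrite ler_wpM2l // ltW.
  by rewrite /L; lra.
- move=> v; rewrite -deriveEjacobian //; apply: le_trans (der0 v) _.
  by rewrite ler_wpM2r // /L; lra.
- by rewrite /L; lra.
- move=> x xr; rewrite -deriveEjacobian //.
  have := @segment_bound _ _ f y0 (x - y0) ('D_(x - y0) f y0)
    (L * `|x - y0| ^+ 2) df.
  rewrite [y0 + (x - y0)]addrC subrK; apply=> t t01.
  have wr : `|y0 + t *: (x - y0) - y0| < r.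
    apply: ball_convex => //; first by rewrite subrr normr0.
    by rewrite [y0 + _]addrC subrK.
  apply: le_trans (derb _ _ wr) _.
  rewrite addrAC subrr add0r normrZ.
  have /andP[t0 t1] := t01; rewrite (ger0_norm t0).
  have -> : D * `|x - y0| * (t * `|x - y0|) = t * D * `|x - y0| ^+ 2 by ring.
  rewrite ler_wpM2r ?exprn_ge0 //.
  have : t * D <= 1 * D by rewrite ler_wpM2r.
  by rewrite /L; lra.
Qed.

End LocalModel.

(** * Expansion of the exact solution *)

Section ExactSolution.
Context {R : realType} {d : nat}.
Local Notation V := 'rV[R]_d.
Local Open Scope classical_set_scope.

Lemma is_derive_scalel (p : R -> R) (w : V) (t p' : R) :
  is_derive t 1 p p' -> is_derive t 1 (fun s => p s *: w) (p' *: w).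
Proof.
move=> [dp pp']; have dp' : differentiable p t by exact/derivable1_diffP.
split; first by apply/derivable1_diffP; exact: differentiableZl.
rewrite deriveE; last exact: differentiableZl.
by rewrite diffZl // -pp' deriveE.
Qed.

Lemma local_model_bound (f : V -> V) y0 J r L x : local_model f y0 J r L ->
  `|x - y0| < r -> `|f x| <= L + L * r.
Proof.
move=> [lip _ val _] xr.
have r0 : 0 < r by apply: le_lt_trans xr.
have L0 : 0 <= L by apply: le_trans val.
rewrite -[f x](subrK (f y0)) addrC.
apply: le_trans (ler_normD _ _) _; apply: lerD => //.
have y0r : `|y0 - y0| < r by rewrite subrr normr0.
by apply: le_trans (lip _ _ xr y0r) _; rewrite ler_wpM2l // ltW.
Qed.

(** Bootstrapping with the mean value inequality: a bound on F along the
    solution gives y - y0 = O(t), then Lipschitz continuity gives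
    y - y0 - t F(y0) = O(t^2), and the Taylor estimate gives the last order. *)
Lemma exact_solution_expansion (F : V -> V) y0 J r L T (y : R -> V) :
  0 < r -> 0 < T -> local_model F y0 J r L -> ode_solution F y0 T y ->
  exists C, \forall h \near (0 : R)^'+,
    `|y h - (y0 + h *: F y0 + (h ^+ 2 / 2) *: (F y0 *m J))| <= C * h ^+ 3.
Proof.
move=> r0 T0 HF [y00 dy]; have [lip linb val tay] := HF.
have L0 : 0 <= L by apply: le_trans val.
pose M := L + L * r.
have M0 : 0 <= M by rewrite addr_ge0 // mulr_ge0 // ltW.
have ycont : {for 0, continuous y}.
  apply: differentiable_continuous; apply/derivable1_diffP.
  suff [] : is_derive 0 (1 : R) y (F (y 0)) by [].
  by apply: dy; rewrite normr0.
have /nbhs_normP[e /= e0 ye] : \forall t \near (0 : R), `|y t - y0| < r.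
  rewrite -y00; have /cvgrPdist_lt/(_ _ r0) := ycont.
  by apply: filterS => t; rewrite distrC.
pose del := Num.min e T.
have del0 : 0 < del by rewrite lt_min e0.
exists (L * M ^+ 2 + L * (L * M)).
suff main h : 0 <= h -> h < del ->
    `|y h - (y0 + h *: F y0 + (h ^+ 2 / 2) *: (F y0 *m J))|
      <= (L * M ^+ 2 + L * (L * M)) * h ^+ 3.
  by near=> h; apply: main; [by []|near: h; exact: nbhs_right_lt].
have yr t : 0 <= t -> t < del -> `|y t - y0| < r.
  move=> t0; rewrite lt_min => /andP[te _]; apply: ye.
  by rewrite /= sub0r normrN ger0_norm.
have dyt t : 0 <= t -> t < del -> is_derive t 1 y (F (y t)).
  move=> t0; rewrite lt_min => /andP[_ tT]; apply: dy.
  by rewrite ger0_norm.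
have step1 t : 0 <= t -> t < del -> `|y t - y0| <= M * t.
  move=> t0 td; rewrite -y00.
  apply: (@mean_value_bound _ _ y (F \o y)) => // s /andP[s0 st].
    by apply: dyt => //; apply: le_lt_trans td.
  apply: local_model_bound HF _; apply: yr => //.
  exact: le_lt_trans td.
have id_der (s : R) : is_derive s 1 (fun s : R => s) (1 : R).
  exact: is_derive_id.
have step2 t : 0 <= t -> t < del -> `|y t - y0 - t *: F y0| <= L * M * t ^+ 2.
  move=> t0 td.
  pose g s := y s - s *: F y0.
  have -> : y t - y0 - t *: F y0 = g t - g 0.
    by rewrite /g scale0r subr0 y00 addrAC.
  rewrite expr2 mulrA.
  apply: (@mean_value_bound _ _ g (fun s => F (y s) - F y0))
    => // s /andP[s0 st].
    have Fy : is_derive s 1 y (F (y s)).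
      by apply: dyt => //; apply: le_lt_trans td.
    have wy := is_derive_scalel _ (F y0) _ _ (id_der s).
    by rewrite -[F y0]scale1r; exact: is_deriveB.
  have sd : s < del by apply: le_lt_trans td.
  apply: le_trans (lip _ _ (yr _ s0 sd) _) _; first by rewrite subrr normr0.
  rewrite -mulrA ler_wpM2l //; apply: le_trans (step1 _ s0 sd) _.
  by rewrite ler_wpM2l.
move=> h0 hd; set w := F y0 *m J.
pose g s := y s - s *: F y0 - (s ^+ 2 / 2) *: w.
have -> : y h - (y0 + h *: F y0 + (h ^+ 2 / 2) *: w) = g h - g 0.
  rewrite /g scale0r subr0 expr0n mul0r scale0r subr0 y00.
  by rewrite !opprD !addrA [RHS]addrAC [y h - _ - y0]addrAC.
have -> : (L * M ^+ 2 + L * (L * M)) * h ^+ 3 =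
  (L * M ^+ 2 + L * (L * M)) * h ^+ 2 * h by ring.
apply: (@mean_value_bound _ _ g (fun s => F (y s) - F y0 - s *: w))
  => // s /andP[s0 sh].
  have Fy : is_derive s 1 y (F (y s)).
    by apply: dyt => //; apply: le_lt_trans hd.
  have wy := is_derive_scalel _ (F y0) _ _ (id_der s).
  have sq : is_derive s 1 (fun s : R => s ^+ 2 / 2) s.
    have -> : (fun u : R => u ^+ 2 / 2) = 2^-1 \*: (id * id : R -> R).
      by apply/funext => u; rewrite /= [RHS]mulrC expr2.
    apply: is_derive_eq; rewrite -scalerDl [_ *: 1]mulr1.
    by rewrite [LHS]mulrC /=; field.
  have w2 := is_derive_scalel _ w _ _ sq.
  rewrite -[F y0]scale1r.
  exact: is_deriveB.
have sd : s < del by apply: le_lt_trans hd.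
have -> : F (y s) - F y0 - s *: w =
    (F (y s) - F y0 - (y s - y0) *m J) + (y s - y0 - s *: F y0) *m J.
  by rewrite [(_ - s *: _) *m J]mulmxBl -scalemxAl addrA subrK.
apply: le_trans (ler_normD _ _) _.
have sh2 : s ^+ 2 <= h ^+ 2 by rewrite lerXn2r // nnegrE.
rewrite mulrDl; apply: lerD.
  apply: le_trans (tay _ (yr _ s0 sd)) _.
  rewrite -mulrA ler_wpM2l // -exprMn lerXn2r ?nnegrE ?mulr_ge0 //.
  by apply: le_trans (step1 _ s0 sd) _; rewrite ler_wpM2l.
apply: le_trans (linb _) _; rewrite -mulrA ler_wpM2l //.
by apply: le_trans (step2 _ s0 sd) _; rewrite ler_wpM2l // mulr_ge0.
Unshelve. all: by end_near. Qed.

End ExactSolution.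

(** * Methods with partitioned stages *)

(** Completeness and the norm of real matrices are joined here, since the
    contraction principle is applied to the matrix of all stages. *)
HB.instance Definition _ (R : realType) (m n : nat) :=
  Complete.on 'M[R]_(m, n).

Section PartitionedMethods.
Context {R : realType} {d : nat} {I K : finType}.
Local Notation V := 'rV[R]_d.
Variables (part : I -> K) (A : I -> I -> R) (b c : I -> R).
Local Open Scope classical_set_scope.

(** A GARK method with any number of partitions, seen as one Runge-Kutta tableau
    whose stage [j] evaluates the vector field of its partition [part j].  The
    stages of all partitions then share a single stage equation. *)
Definition partitioned_step (f : K -> V -> V) (h : R) (y0 : V)
    (Y : I -> V) (y1 : V) : Prop :=
  (forall i, Y i = y0 + h *: \sum_j A i j *: f (part j) (Y j)) /\
  y1 = y0 + h *: \sum_j b j *: f (part j) (Y j).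

Lemma norm_weighted_sum (a : I -> R) (u : I -> V) (B : R) :
  (forall j, `|u j| <= B) -> `|\sum_j a j *: u j| <= (\sum_j `|a j|) * B.
Proof.
move=> uB; apply: le_trans (ler_norm_sum _ _ _) _.
rewrite mulr_suml; apply: ler_sum => j _.
by rewrite normrZ ler_wpM2l.
Qed.

(** Turns conditions on the separate partitions into statements about the sum of
    the vector fields. *)
Lemma sum_by_partition (a : I -> R) (u : K -> V) :
  \sum_j a j *: u (part j) = \sum_k (\sum_(j | part j == k) a j) *: u k.
Proof.
rewrite (partition_big part xpredT) //=; apply: eq_bigr => k _.
by rewrite scaler_suml; apply: eq_bigr => j /eqP->.
Qed.

Let S := \sum_i \sum_j `|A i j| + \sum_j `|b j|.

Let S0 : 0 <= S.
Proof. by rewrite addr_ge0 ?sumr_ge0 // => i _; rewrite sumr_ge0. Qed.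

Let rowS i : \sum_j `|A i j| <= S.
Proof.
rewrite /S [X in _ <= X + _](bigD1 i) //= -addrA lerDl addr_ge0 ?sumr_ge0 //.
move=> k _; by rewrite sumr_ge0.
Qed.

Let weightS : \sum_j `|b j| <= S.
Proof. by rewrite /S lerDr sumr_ge0 // => i _; rewrite sumr_ge0. Qed.

Section LocalModels.
Variables (f : K -> V -> V) (y0 : V) (J : K -> 'M[R]_d) (r L : R).
Hypothesis r0 : 0 < r.
Hypothesis fm : forall k, local_model (f k) y0 (J k) r L.
Hypothesis L0 : 0 <= L.

Lemma local_model_sum :
  local_model (fun x => \sum_k f k x) y0 (\sum_k J k) r (#|K|%:R * L).
Proof.
have sumb (u : K -> V) (B : R) : (forall k, `|u k| <= L * B) ->
    `|\sum_k u k| <= #|K|%:R * L * B.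
  move=> uB; apply: le_trans (ler_norm_sum _ _ _) _.
  rewrite -mulrA mulr_natl -sumr_const; exact: ler_sum.
split.
- move=> x z xr zr; rewrite -sumrB; apply: sumb => k.
  by have [+ _ _ _] := fm k; exact.
- by move=> v; rewrite mulmx_sumr; apply: sumb => k; have [] := fm k.
- rewrite -[leRHS]mulr1; apply: sumb => k; rewrite mulr1.
  by have [] := fm k.
- move=> x xr; rewrite mulmx_sumr -!sumrB; apply: sumb => k.
  by have [_ _ _ +] := fm k; exact.
Qed.

Let M := L + L * r.
Let M0 : 0 <= M. Proof. by rewrite addr_ge0 // mulr_ge0 // ltW. Qed.

Section Expansion.
Hypothesis consistent : forall i k, \sum_(j | part j == k) A i j = c i.
Hypothesis b_sum : forall k, \sum_(j | part j == k) b j = 1.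
Hypothesis bc_sum : forall k, \sum_(j | part j == k) b j * c j = 1 / 2%:R.

(** Internal consistency makes Y_i agree with y0 + h c_i F(y0) up to O(h^2) for
    the full field F although stage i uses a single component; the Taylor
    estimate then gives the stage values up to O(h^2), and the weights turn
    h c_i into h^2 / 2. *)
Lemma numerical_expansion (F0 := \sum_k f k y0) (J0 := \sum_k J k) :
  exists C, forall h Y y1, 0 <= h -> partitioned_step f h y0 Y y1 ->
    (forall i, `|Y i - y0| < r) ->
    `|y1 - (y0 + h *: F0 + (h ^+ 2 / 2) *: (F0 *m J0))| <= C * h ^+ 3.
Proof.
(* The first term of B bounds the Taylor remainder of a stage value, the second
   one the image under the Jacobian of the error of the stage. *)
pose B := L * (S * M) ^+ 2 + L * (S * (L * (S * M))).
have B0 : 0 <= B by rewrite addr_ge0 // mulr_ge0 ?exprn_ge0 // !mulr_ge0.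
exists (S * B) => h Y y1 h0 [HY Hy] Yr.
have y0r : `|y0 - y0| < r by rewrite subrr normr0.
have EA i : \sum_j A i j *: f (part j) y0 = c i *: F0.
  rewrite (sum_by_partition (A i) (fun k => f k y0)) scaler_sumr.
  by apply: eq_bigr => k _; rewrite consistent.
have EY i : `|Y i - y0| <= h * (S * M).
  rewrite HY addrAC subrr add0r normrZ (ger0_norm h0) ler_wpM2l //.
  apply: le_trans (@norm_weighted_sum _ _ M _) _; last by rewrite ler_wpM2r.
  by move=> j; exact: local_model_bound (fm _) (Yr j).
have Ef j : `|f (part j) (Y j) - f (part j) y0| <= h * (L * (S * M)).
  have [lip _ _ _] := fm (part j).
  apply: le_trans (lip _ _ (Yr j) y0r) _.
  by rewrite mulrCA ler_wpM2l.
have EZ i : `|Y i - y0 - (h * c i) *: F0| <= h ^+ 2 * (S * (L * (S * M))).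
  have -> : Y i - y0 - (h * c i) *: F0 =
      h *: \sum_j A i j *: (f (part j) (Y j) - f (part j) y0).
    rewrite {1}HY [y0 + _ - y0]addrAC subrr add0r.
    under [in RHS]eq_bigr do rewrite scalerBr.
    by rewrite sumrB scalerBr EA scalerA.
  rewrite normrZ (ger0_norm h0) expr2 -mulrA ler_wpM2l //.
  apply: le_trans (norm_weighted_sum _ _ _ Ef) _.
  by rewrite mulrCA ler_wpM2l // ler_wpM2r // !mulr_ge0.
pose Z j := f (part j) (Y j) - f (part j) y0 - (h * c j) *: (F0 *m J (part j)).
have ZB j : `|Z j| <= h ^+ 2 * B.
  have [_ linb _ tay] := fm (part j).
  have -> : Z j = (f (part j) (Y j) - f (part j) y0 - (Y j - y0) *m J (part j))
      + (Y j - y0 - (h * c j) *: F0) *m J (part j).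
    by rewrite [(_ - _ *: _) *m _]mulmxBl -scalemxAl addrA subrK.
  apply: le_trans (ler_normD _ _) _; rewrite mulrDr; apply: lerD.
    apply: le_trans (tay _ (Yr j)) _; rewrite [leRHS]mulrCA ler_wpM2l //.
    by rewrite -exprMn lerXn2r ?nnegrE // !mulr_ge0.
  apply: le_trans (linb _) _; rewrite [leRHS]mulrCA ler_wpM2l //.
have -> : y1 - (y0 + h *: F0 + (h ^+ 2 / 2) *: (F0 *m J0)) =
    h *: \sum_j b j *: Z j.
  have EF : \sum_j b j *: f (part j) y0 = F0.
    rewrite (sum_by_partition b (fun k => f k y0)).
    by apply: eq_bigr => k _; rewrite b_sum scale1r.
  have EJ : \sum_j (b j * c j) *: (F0 *m J (part j)) = (1 / 2) *: (F0 *m J0).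
    rewrite (sum_by_partition (fun j => b j * c j) (fun k => F0 *m J k)).
    under eq_bigr do rewrite bc_sum.
    by rewrite -scaler_sumr mulmx_sumr.
  have -> : \sum_j b j *: Z j = \sum_j b j *: f (part j) (Y j) - F0
      - h *: ((1 / 2) *: (F0 *m J0)).
    rewrite -EJ -[X in _ - X - _]EF scaler_sumr -!sumrB; apply: eq_bigr => j _.
    by rewrite /Z !scalerBr !scalerA mulrCA.
  rewrite Hy !scalerBr !scalerA !opprD !addrA [y0 + _ - y0]addrAC subrr add0r.
  by rewrite expr2 mul1r.
rewrite normrZ (ger0_norm h0).
rewrite [leRHS](_ : _ = h * (S * (h ^+ 2 * B))); last by ring.
rewrite ler_wpM2l //; apply: le_trans (norm_weighted_sum _ _ _ ZB) _.
by rewrite ler_wpM2r // mulr_ge0 // exprn_ge0.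
Qed.

End Expansion.

(** For small h the map defined by the right side of the stage equations sends
    the closed ball of radius r / 2 around the constant stages y0 to itself and
    contracts distances by 1 / 2. *)
Lemma stages_exist : \forall h \near (0 : R)^'+,
  exists Y : I -> V,
    (forall i, Y i = y0 + h *: \sum_j A i j *: f (part j) (Y j)) /\
    (forall i, `|Y i - y0| < r).
Proof.
pose del := Num.min (r / 2 / (S * M + 1)) (1 / 2 / (S * L + 1)).
have SM0 : 0 < S * M + 1 by rewrite ltr_wpDl // mulr_ge0.
have SL0 : 0 < S * L + 1 by rewrite ltr_wpDl // mulr_ge0.
have del0 : 0 < del by rewrite lt_min !divr_gt0.
suff main h : 0 <= h -> h < del -> exists Y : I -> V,
    (forall i, Y i = y0 + h *: \sum_j A i j *: f (part j) (Y j)) /\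
    (forall i, `|Y i - y0| < r).
  by near=> h; apply: main; [by []|near: h; exact: nbhs_right_lt].
move=> h0; rewrite lt_min => /andP[hM hL].
have hSM : h * (S * M) <= r / 2.
  move: hM; rewrite ltr_pdivlMr // => /ltW; apply: le_trans.
  by rewrite ler_wpM2l // lerDl.
have hSL : h * (S * L) <= 1 / 2.
  move: hL; rewrite ltr_pdivlMr // => /ltW; apply: le_trans.
  by rewrite ler_wpM2l // lerDl.
pose st (X : 'M[R]_(#|I|, d)) (i : I) : V := row (enum_rank i) X.
pose X0 : 'M[R]_(#|I|, d) := \matrix_i y0.
pose U := closed_ball_ (fun x => `|x|) X0 (r / 2).
have norm_st X i : `|st X i| <= `|X|.
  apply: rV_norm_le => // j; rewrite mxE [leRHS]/Num.Def.normr /= mx_normrE.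
  exact: (le_bigmax _ (fun ij : 'I_#|I| * 'I_d => `|X ij.1 ij.2|) (_, j)).
have st_norm X B : 0 <= B -> (forall i, `|st X i| <= B) -> `|X| <= B.
  move=> B0 XB; rewrite [leLHS]/Num.Def.normr /= mx_normrE.
  apply: bigmax_le => // -[i j] _ /=.
  have := le_trans (rV_coord_le _ j) (XB (enum_val i)).
  by rewrite mxE enum_valK.
have stB X Z i : st (X - Z) i = st X i - st Z i by rewrite /st linearB.
have st0 i : st X0 i = y0 by rewrite /st rowK.
have UP X i : U X -> `|st X i - y0| <= r / 2.
  rewrite /U /closed_ball_ /= distrC => UX.
  by rewrite -(st0 i) -stB; apply: le_trans UX.
have half_r : r / 2 < r by rewrite ltr_pdivrMr // mulr_natr mulr2n ltrDl.
pose Phi (X : 'M[R]_(#|I|, d)) : 'M[R]_(#|I|, d) :=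
  \matrix_i (y0 + h *: \sum_j A (enum_val i) j *: f (part j) (st X j)).
have stPhi X i : st (Phi X) i = y0 + h *: \sum_j A i j *: f (part j) (st X j).
  by rewrite /st rowK enum_rankK.
have PhiU : {homo Phi : x / U x >-> U x}.
  move=> X UX; rewrite /U /closed_ball_ /= distrC.
  apply: st_norm => [|i]; first by rewrite ltW // divr_gt0.
  rewrite stB stPhi st0 addrAC subrr add0r normrZ (ger0_norm h0).
  apply: le_trans hSM; rewrite ler_wpM2l //.
  apply: le_trans (@norm_weighted_sum _ _ M _) _; last by rewrite ler_wpM2r.
  move=> j; apply: local_model_bound (fm _) _.
  exact: le_lt_trans (UP _ _ UX) half_r.
have q0 : 0 <= 1 / 2 :> R by rewrite divr_ge0.
have ctr : is_contraction (mkfun PhiU : {fun U >-> U}).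
  exists (NngNum q0); split => /=; first by rewrite ltr_pdivrMr // mul1r ltr1n.
  move=> [X Z] /= [UX UZ].
  apply: st_norm => [|i]; first by rewrite mulr_ge0.
  rewrite stB !stPhi opprD addrACA subrr add0r -scalerBr -sumrB.
  under eq_bigr do rewrite -scalerBr.
  rewrite normrZ (ger0_norm h0).
  apply: (@le_trans _ _ (h * (S * L) * `|X - Z|)); last by rewrite ler_wpM2r.
  rewrite -!mulrA ler_wpM2l //.
  apply: le_trans (@norm_weighted_sum _ _ (L * `|X - Z|) _) _.
    move=> j; have [lip _ _ _] := fm (part j).
    apply: le_trans (lip _ _ _ _) _;
      [exact: le_lt_trans (UP _ _ _) half_r..|].
    by rewrite ler_wpM2l // -stB.
  by rewrite ler_wpM2r // mulr_ge0.
have [||X UX XE] := banach_fixed_point ctr.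
- exact: closed_closed_ball_.
- exists X0; rewrite /U /closed_ball_ /= subrr normr0.
  by rewrite ltW // divr_gt0.
exists (st X); split=> i; first by rewrite {1}XE /= stPhi.
exact: le_lt_trans (UP _ _ UX) half_r.
Unshelve. all: by end_near. Qed.

End LocalModels.
End PartitionedMethods.

(** * Second order *)

Section PartitionedOrder.
Context {R : realType} {d : nat} {I K : finType}.
Local Notation V := 'rV[R]_d.
Local Open Scope classical_set_scope.

Lemma common_local_model (f : K -> V -> V) (y0 : V) :
  (forall k, Ck 2 (f k)) ->
  exists r L, [/\ 0 < r, 0 <= L &
    forall k, local_model (f k) y0 (jacobian (f k) y0) r L].
Proof.
move=> f2.
have [r_ rP] := choice (fun k => Ck2_local_model (f k) y0 (f2 k)).
have [L_ LP] := choice rP.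
have L0 k : 0 <= L_ k by have [_ [_ _ + _]] := LP k; exact: le_trans.
(* The neutral element 1 of the minimum keeps the radius positive when K is
   empty. *)
exists (\big[Num.min/1]_k r_ k), (\sum_k L_ k); split.
- by apply: lt_bigmin => // k _; have [] := LP k.
- exact: sumr_ge0.
- move=> k; have [_] := LP k; apply: local_model_weaken.
    exact: bigmin_le_cond.
  by rewrite (bigD1 k) //= lerDl sumr_ge0.
Qed.

(** The exact and the numerical solution share their expansion up to O(h^3). *)
Lemma partitioned_order2 (part : I -> K) (A : I -> I -> R) (b c : I -> R)
    (f : K -> V -> V) :
  (forall i k, \sum_(j | part j == k) A i j = c i) ->
  (forall k, \sum_(j | part j == k) b j = 1) ->
  (forall k, \sum_(j | part j == k) b j * c j = 1 / 2%:R) ->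
  (forall k, Ck 2 (f k)) ->
  local_error_order 2 (fun x => \sum_k f k x) (partitioned_step part A b f).
Proof.
move=> cons b1 bc f2 y0 T y T0 sol.
have [r [L [r0 L0 fm]]] := common_local_model _ y0 f2.
have [C1 near1] :=
  exact_solution_expansion _ _ _ _ _ _ _ r0 T0
    (local_model_sum _ _ _ _ _ fm) sol.
have [C2 H2] := numerical_expansion _ _ _ _ _ _ _ _ _ r0 fm L0 cons b1 bc.
exists r, (C2 + C1); split=> //; near=> h.
have h0 : 0 <= h by [].
split.
  have [Y [HY Yr]] : exists Y : I -> V,
      (forall i, Y i = y0 + h *: \sum_j A i j *: f (part j) (Y j)) /\
      (forall i, `|Y i - y0| < r).
    by near: h; exact: (stages_exist part A b _ _ _ _ _ r0 fm L0).
  by exists Y, (y0 + h *: \sum_j b j *: f (part j) (Y j)).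
move=> Y y1 st Yr; rewrite mulrDl.
apply: le_trans (ler_distD (y0 + h *: (\sum_k f k y0)
  + (h ^+ 2 / 2) *: ((\sum_k f k y0) *m (\sum_k jacobian (f k) y0))) _ _) _.
apply: lerD; first exact: H2 h0 st Yr.
by rewrite distrC; near: h; exact: near1.
Unshelve. all: by end_near. Qed.

End PartitionedOrder.

Section GarkOrder.
Context {R : realType} {mf ms d : nat}.
Variables (Aff : 'M[R]_mf) (Afs : 'M[R]_(mf, ms)).
Variables (Asf : 'M[R]_(ms, mf)) (Ass : 'M[R]_ms).
Variables (bf : 'cV[R]_mf) (bs : 'cV[R]_ms).

(** The partition [true] collects the fast stages and [false] the slow ones. *)
Definition gark_part (i : 'I_mf + 'I_ms) : bool :=
  if i is inl _ then true else false.

Definition gark_A (i j : 'I_mf + 'I_ms) : R :=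
  match i, j with
  | inl i, inl j => Aff i j
  | inl i, inr j => Afs i j
  | inr i, inl j => Asf i j
  | inr i, inr j => Ass i j
  end.

Definition gark_weight (uf : 'cV[R]_mf) (us : 'cV[R]_ms)
    (i : 'I_mf + 'I_ms) : R :=
  match i with inl i => uf i 0 | inr i => us i 0 end.

Lemma gark_sum_part (u : 'I_mf + 'I_ms -> R) (k : bool) :
  \sum_(j | gark_part j == k) u j =
  if k then \sum_j u (inl j) else \sum_j u (inr j).
Proof.
rewrite big_mkcond big_sumType /=; case: k => /=.
  by rewrite [X in _ + X]big1_eq addr0.
by rewrite big1_eq add0r.
Qed.

Lemma gark_partitioned (ff fs : 'rV[R]_d -> 'rV[R]_d) H y0 Yf Ys y1 :
  gark_step Aff Afs Asf Ass bf bs ff fs H y0 Yf Ys y1 <->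
  partitioned_step gark_part gark_A (gark_weight bf bs)
    (fun k => if k then ff else fs) H y0
    (fun i => match i with inl i => Yf i | inr i => Ys i end) y1.
Proof.
rewrite /partitioned_step !big_sumType /=; split=> [[Hf Hs ->]|[Hst ->]].
  by split=> // -[i|i]; rewrite big_sumType.
by split=> // i; [have := Hst (inl i)|have := Hst (inr i)]; rewrite big_sumType.
Qed.

End GarkOrder.

Section MisOrder.
Context {R : realType} {n si : nat}.
Variables (Ao : 'M[R]_n.+1) (bo : 'cV[R]_n.+1).
Variables (Ai : 'M[R]_si) (bi : 'cV[R]_si).
Local Notation co := (abscissae Ao).
Local Notation ci := (abscissae Ai).
Hypothesis Ao_explicit : explicit_rk Ao.
Hypothesis co0 : co ord0 0 = 0.
Hypothesis bo1 : \sum_j bo j 0 = 1.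
Hypothesis bi1 : \sum_j bi j 0 = 1.
Hypothesis boco : \sum_j bo j 0 * co j 0 = 1 / 2%:R.
Hypothesis bici : \sum_j bi j 0 * ci j 0 = 1 / 2%:R.

(** Internal consistency and the first two moments of each partition are what
    the order of a partitioned method requires; the stages of the MIS scheme are
    those of the GARK method, listed by block. *)
Lemma mis_order2 : mis_order 2 Ao bo Ai bi.
Proof.
exists 2%N => d fs ff fs2 ff2 y0 T y T0 sol.
pose f (k : bool) := if k then ff else fs.
have f2 k : Ck 2 (f k) by case: k; [exact: ff2|exact: fs2].
pose A := gark_A (mis_Aff Ao Ai bi) (mis_Afs Ao bo Ai) (mis_Asf Ao bi) Ao.
pose b := gark_weight (mis_bf Ao bi) bo.
pose c := gark_weight (mis_cf Ao Ai) co.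
have cons i k : \sum_(j | gark_part j == k) A i j = c i.
  rewrite gark_sum_part; case: i k => i [] /=.
  - by rewrite -mulmx1E mis_Aff1.
  - by rewrite -mulmx1E mis_Afs1.
  - by rewrite -mulmx1E mis_Asf1.
  - by rewrite abscissaeE.
have b1 k : \sum_(j | gark_part j == k) b j = 1.
  by rewrite gark_sum_part; case: k; rewrite //= sum_bf1.
have bc k : \sum_(j | gark_part j == k) b j * c j = 1 / 2%:R.
  by rewrite gark_sum_part; case: k; rewrite //= sum_bf_cf.
have sumf : (fun x => \sum_k f k x) = (fun x => fs x + ff x).
  by apply/funext => x; rewrite big_bool addrC.
have sol' : ode_solution (fun x => \sum_k f k x) y0 T y by rewrite sumf.
have [r [C [r0 near_h]]] :=
  partitioned_order2 _ _ _ _ _ cons b1 bc f2 _ _ _ T0 sol'.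
exists r, C; split=> //; apply: filterS near_h => h [[Z [y1 [st Zr]]] bound].
split=> [|Y z1 stY Yr].
  exists (fun i => match i with
    | inl k => Z (inr k)
    | inr (l, q) => Z (inl (tagnat.Rank (p_ := fun _ => si) l q)) end), y1.
  split; last by case=> [k|[l q]]; exact: Zr.
  apply/(mis_gark _ _ _ _ Ao_explicit)/gark_partitioned.
  rewrite [X in partitioned_step _ _ _ _ _ _ X _](_ : _ = Z) //.
  by apply/funext => -[i|i] //; rewrite tagnat.sig2K.
apply: bound (iffLR (gark_partitioned _ _ _ _ _ _ _ _ _ _ _ _ _)
  (iffLR (mis_gark _ _ _ _ Ao_explicit _ _ _ _ _ _ _) stY)) _.
by case=> i; exact: Yr.
Qed.

End MisOrder.

Theorem theorem3p1 (R : realType) (n si : nat)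
    (Ao : 'M[R]_n.+1) (bo : 'cV[R]_n.+1) (Ai : 'M[R]_si) (bi : 'cV[R]_si)
    (co := abscissae Ao)
    (Aff := mis_Aff Ao Ai bi) (Afs := mis_Afs Ao bo Ai)
    (Asf := mis_Asf Ao bi) (Ass := Ao)
    (bf := mis_bf Ao bi) (bs := bo)
    (cf := mis_cf Ao Ai) (cs := co)
    (Ao_explicit : explicit_rk Ao)
    (co_first : co ord0 0 = 0)
    (co_incr : forall i j : 'I_n.+1, (i < j)%N -> co i 0 < co j 0)
    (co_last : co ord_max 0 < 1)
    (bo_sum : (bo^T *m (const_mx 1 : 'cV[R]_n.+1)) 0 0 = 1)
    (bi_sum : (bi^T *m (const_mx 1 : 'cV[R]_si)) 0 0 = 1) :
  [/\
      forall (d : nat) (fs ff : 'rV[R]_d -> 'rV[R]_d) (H : R) (y0 : 'rV[R]_d)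
        (Ys : 'I_n.+1 -> 'rV[R]_d) (Yf : 'I_n.+1 -> 'I_si -> 'rV[R]_d)
        (y1 : 'rV[R]_d),
        mis_step Ao bo Ai bi fs ff H y0 Ys Yf y1 <->
        gark_step Aff Afs Asf Ass bf bs ff fs H y0
          (fun i => Yf (tagnat.sig1 i) (tagnat.sig2 i)) Ys y1,
      [/\ Ass *m const_mx 1 = cs, Asf *m const_mx 1 = cs,
          Afs *m const_mx 1 = cf & Aff *m const_mx 1 = cf],
      rk_order 2 Ai bi -> rk_order 2 Ao bo -> mis_order 2 Ao bo Ai bi
    &
      rk_order 3 Ai bi -> rk_order 3 Ao bo ->
      ((bs^T *m Asf *m cf) 0 0 = 1 / 6%:R /\
       (bf^T *m Afs *m cs) 0 0 = 1 / 6%:R)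
      <->
      1 / 3%:R =
        \sum_(k < n)
           (co (nxt k) 0 - co (prv k) 0) *
           ((unitv R (nxt k) + unitv R (prv k))^T *m Ao *m co) 0 0
        + (1 - co ord_max 0) *
          (1 / 2%:R + ((unitv R ord_max)^T *m Ao *m co) 0 0)].
Proof.
rewrite !weight_sum in bo_sum bi_sum.
split.
- by move=> d fs ff H y0 Ys Yf y1; exact: mis_gark.
- split=> //; [exact: mis_Asf1|exact: mis_Afs1|exact: mis_Aff1].
- move=> /(rk_order_quadrature 2 1 _ _ isT) bici.
  move=> /(rk_order_quadrature 2 1 _ _ isT) boco.
  exact: mis_order2.
move=> oi oo.
have bici := rk_order_quadrature 3 1 _ _ isT oi.
have boco := rk_order_quadrature 3 1 _ _ isT oo.
have boco2 := rk_order_quadrature 3 2 _ _ isT oo.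
rewrite /bf /Afs /cs coupling_fast //; set X := (_ + _ : R).
split=> [[_ X6]|X3]; first by move: X6; lra.
split; last by rewrite -X3; field.
exact: coupling_slow.
Qed.
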